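(* For all $i,j\in\{1,2\}$ there exist $\mathbb V_0^{\bm k}$-valued rational functions $A_{ij}(z,w)$ and $B_{ij}(z,w)$ of the two complex variables $z,w$ such that $$\varsigma_i(z)_{(0)}\,\varsigma_j(w)=\big(j\,D_z^{(i)}-i\,D_w^{(j)}\big)A_{ij}(z,w)+T\,B_{ij}(z,w),$$ and moreover such that $A_{ij}(z,w)$ is regular at $z=w$ up to terms of the form $TZ$ with $Z\in\mathbb V_0^{\bm k}$ (i.e. in the Laurent expansion of $A_{ij}(z,w)$ in $w$ about $w=z$, all coefficients of strictly negative powers of $w-z$ lie in the image of $T$).
   Context: Work over $\mathbb C$. Fix an integer $M\ge 3$ and let $(X|Y)=\operatorname{tr}(XY)$ on $\mathfrak{sl}_M$ (trace in the defining $M\times M$ representation). The affine algebra $\widehat{\mathfrak{sl}}_M=\mathfrak{sl}_M[t,t^{-1}]\oplus\mathbb C\mathsf k$ has $\mathsf k$ central and, with $a_n:=a\otimes t^n$, $[a_m,b_n]=[a,b]_{m+n}-n\,\delta_{m+n,0}(a|b)\mathsf k$. Fix $N\ge 1$, distinct points $z_1,\dots,z_N\in\mathbb C$, and $\bm k=(k_1,\dots,k_N)\in\mathbb C^N$ with $k_i\neq -M$ for all $i$. For $A\in\widehat{\mathfrak{sl}}_M$ let $A^{(i)}$ be its copy in the $i$-th summand of $\widehat{\mathfrak{sl}}_M^{\oplus N}$. Let $\mathbb V_0^{\bm k}$ be the $\widehat{\mathfrak{sl}}_M^{\oplus N}$-module induced from the one-dimensional module $\mathbb C|0\rangle^{\bm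 k}$ over $(\mathfrak{sl}_M[t]\oplus\mathbb C\mathsf k)^{\oplus N}$ on which $\mathsf k^{(i)}$ acts as $k_i$ and $a_n^{(i)}$ ($n\ge0$) acts as $0$. It is a vertex algebra (the tensor product of the vacuum Verma modules of levels $k_i$) with modes $X_{(n)}$, $Y(X,u)=\sum_{n\in\mathbb Z}X_{(n)}u^{-n-1}$, determined by $(a_{-1}^{(i)}|0\rangle^{\bm k})_{(n)}=a_n^{(i)}$, $Y(TX,u)=\partial_uY(X,u)$, and $Y(X_{(-1)}Y',u)=\,:\!Y(X,u)Y(Y',u)\!:$ (the usual normal ordered product). The translation operator $T$ is the linear map with $T|0\rangle^{\bm k}=0$ and $[T,a_n^{(i)}]=-n\,a_{n-1}^{(i)}$. For $A\in\widehat{\mathfrak{sl}}_M$ put $A(z):=\sum_{i=1}^N\frac{A^{(i)}}{z-z_i}$. Let $I^a=I_a$ ($a=1,\dots,\dim\mathfrak{sl}_M$) be a basis of $\mathfrak{sl}_M$ with $(I_a|I_b)=\delta_{ab}$; repeated Lie algebra indices are summed. Let $t_{abc}:=\operatorname{tr}(I_aI_bI_c+I_bI_aI_c)$. Define $$\varsigma_1(z):=\tfrac12 I^a_{-1}(z)I^a_{-1}(z)|0\rangle^{\bm k},\qquad \varsigma_2(z):=\tfrac13t_{abc}I^a_{-1}(z)I^b_{-1}(z)I^c_{-1}(z)|0\rangle^{\bm k}.$$ Twist function: $\varphi(z):=\sum_{i=1}^N\frac{k_i}{z-z_i}$. Twisted derivative of degree $j\in\mathbb Z$: $D_z^{(j)}:=\partial_z-\frac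 jM\varphi(z)$. A $\mathbb V_0^{\bm k}$-valued rational function is a finite sum of scalar rational functions times vectors of $\mathbb V_0^{\bm k}$. *)

(* Defs.v *)
From HB Require Import structures.
From mathcomp Require Import all_boot all_order all_algebra.

Set Implicit Arguments.
Unset Strict Implicit.
Unset Printing Implicit Defensive.

Import Order.TTheory GRing.Theory Num.Theory.
Local Open Scope ring_scope.

Section SpecialLinear.
Variables (C : fieldType) (M : nat).

Definition trace_fun (a : 'M[C]_M) : C^o := \tr a.

Fact trace_fun_is_linear : linear trace_fun.
Proof. by move=> c a b; rewrite /trace_fun mxtraceD mxtraceZ. Qed.

HB.instance Definition _ :=
  GRing.isLinear.Build C 'M[C]_M C^o *:%R trace_fun trace_fun_is_linear.

Definition sl : {vspace 'M[C]_M} := lker (linfun trace_fun).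

Lemma mem_sl (a : 'M[C]_M) : (a \in sl) = (\tr a == 0).
Proof. by rewrite memv_ker lfunE. Qed.

Definition orthonormal_basis (I : (\dim sl).-tuple 'M[C]_M) : Prop :=
  basis_of sl I /\
  forall a b, \tr (tnth I a *m tnth I b) = (a == b)%:R.

End SpecialLinear.
Arguments sl : clear implicits.

(* Representations of the direct sum of N copies of the affine Lie algebra    *)
(* sl_M[t, t^-1] (+) C k.  [cur i a n] is the action of the element a_n in    *)
(* the i-th copy and [cen i] that of the central k of the i-th copy.  The     *)
(* operator [cur i a n] is meaningful for \tr a = 0 only: nothing is required *)
(* of its values at other matrices, and nothing below depends on them.        *)
Section AffineRepresentations.
Variables (C : fieldType) (M N : nat).

Record affineRep (V : lmodType C) := AffineRep {
  cur : 'I_N -> 'M[C]_M -> int -> {linear V -> V};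
  cen : 'I_N -> {linear V -> V};
  cur_linear : forall i n (c : C) a b v,
    a \in sl C M -> b \in sl C M ->
    cur i (c *: a + b) n v = c *: cur i a n v + cur i b n v;
  cur_bracket : forall i j a b m n v,
    a \in sl C M -> b \in sl C M ->
    cur i a m (cur j b n v) - cur j b n (cur i a m v) =
    if i == j then
      cur i (a *m b - b *m a) (m + n) v
      - (if m + n == 0 then (n%:~R * \tr (a *m b)) *: cen i v else 0)
    else 0;
  cen_cur : forall i j a n v,
    a \in sl C M -> cen i (cur j a n v) = cur j a n (cen i v);
  cen_cen : forall i j v, cen i (cen j v) = cen j (cen i v)
}.

(* w spans a copy (or a quotient) of the one-dimensional module of            *)
(* (sl_M[t] (+) C k)^(+)N on which a_n (n >= 0) is 0 and k^(i) is k_i.        *)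
Definition vacuum_like (V : lmodType C) (rho : affineRep V)
    (k : 'I_N -> C) (w : V) : Prop :=
  (forall i a (n : nat), a \in sl C M -> cur rho i a n%:Z w = 0) /\
  (forall i, cen rho i w = k i *: w).

Definition intertwines (V W : lmodType C) (rho : affineRep V)
    (sigma : affineRep W) (f : V -> W) : Prop :=
  (forall i a n v, a \in sl C M -> f (cur rho i a n v) = cur sigma i a n (f v)) /\
  (forall i v, f (cen rho i v) = cen sigma i (f v)).

(* The induced module, through the defining adjunction of induction:          *)
(* Hom_g (Ind L, W) = Hom_p (L, W), naturally in W, with L one-dimensional    *)
(* spanned by vac.                                                            *)
Definition is_vacuum_module (V : lmodType C) (rho : affineRep V)
    (k : 'I_N -> C) (vac : V) : Prop :=
  vacuum_like rho k vac /\
  forall (W : lmodType C) (sigma : affineRep W) (w : W),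
    vacuum_like sigma k w ->
    exists f : {linear V -> W},
      [/\ intertwines rho sigma f, f vac = w &
          forall g : {linear V -> W},
            intertwines rho sigma g -> g vac = w -> forall v, g v = f v].

Definition is_translation (V : lmodType C) (rho : affineRep V) (vac : V)
    (T : {linear V -> V}) : Prop :=
  T vac = 0 /\
  forall i a n v, a \in sl C M ->
    T (cur rho i a n v) - cur rho i a n (T v) = - (n%:~R *: cur rho i a (n - 1) v).

End AffineRepresentations.

(* Below, Y X n is the mode X_(n), i.e. the coefficient of                    *)
(* u^(-n-1) in the field Y(X, u).                                             *)
Section VertexAlgebras.
Variables (C : fieldType) (V : lmodType C) (vac : V) (T : {linear V -> V}).
Variable Y : V -> int -> {linear V -> V}.

(* va_local is (x - y)^K [Y(X, x), Y(X', y)] = 0, coefficientwise.            *)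
Record is_vertex_algebra : Prop := IsVertexAlgebra {
  va_linear : forall (c : C) X X' n v,
    Y (c *: X + X') n v = c *: Y X n v + Y X' n v;
  va_field : forall X v, exists n0 : int, forall n, n0 <= n -> Y X n v = 0;
  va_vacuum : forall n v, Y vac n v = if n == -1 then v else 0;
  va_creation : forall X, Y X (-1) vac = X;
  va_regular : forall X (n : nat), Y X n%:Z vac = 0;
  va_T_vacuum : T vac = 0;
  va_translation : forall X n v,
    T (Y X n v) - Y X n (T v) = - (n%:~R *: Y X (n - 1) v);
  va_local : forall X X', exists K : nat, forall (m n : int) v,
    \sum_(j < K.+1) ((-1) ^+ j * 'C(K, j)%:R) *:
      (Y X (m + (K - j)%N%:Z) (Y X' (n + j%:Z) v)
       - Y X' (n + j%:Z) (Y X (m + (K - j)%N%:Z) v)) = 0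
}.

(* Y(TX, u) = d/du Y(X, u). *)
Definition modes_of_T : Prop :=
  forall X n v, Y (T X) n v = - (n%:~R *: Y X (n - 1) v).

(* Y(X_(-1) X', u) = :Y(X, u) Y(X', u):.  The coefficient of u^(-m-1) on the  *)
(* right is  sum_(n < 0) X_(n) X'_(m-n-1) + sum_(n >= 0) X'_(m-n-1) X_(n),    *)
(* whose value at v is a sum with finitely many nonzero terms, i.e. an        *)
(* eventually constant sequence of partial sums.                              *)
Definition modes_of_normal_order : Prop :=
  forall X X' m v, exists L0 : nat, forall L : nat, (L0 <= L)%N ->
    Y (Y X (-1) X') m v =
    \sum_(l < L) (Y X (- l.+1%:Z) (Y X' (m + l%:Z) v)
                  + Y X' (m - l%:Z - 1) (Y X l%:Z v)).

End VertexAlgebras.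

Definition is_vacuum_vertex_algebra (C : fieldType) (M N : nat)
    (V : lmodType C) (rho : affineRep M N V) (vac : V) (T : {linear V -> V})
    (Y : V -> int -> {linear V -> V}) : Prop :=
  [/\ is_vertex_algebra vac T Y,
      forall i a n v, a \in sl C M ->
        Y (cur rho i a (-1) vac) n v = cur rho i a n v,
      modes_of_T T Y
    & modes_of_normal_order Y].

Section GaudinStates.
Variables (C : fieldType) (M N : nat) (V : lmodType C).
Variables (rho : affineRep M N V) (vac : V) (p : 'I_N -> C).
Variable I : (\dim (sl C M)).-tuple 'M[C]_M.

Definition cur_at (a : 'M[C]_M) (n : int) (z : C) (v : V) : V :=
  \sum_(i < N) (z - p i)^-1 *: cur rho i a n v.

Definition tabc (a b c : 'I_(\dim (sl C M))) : C :=
  \tr (tnth I a *m tnth I b *m tnth I c + tnth I b *m tnth I a *m tnth I c).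

Definition varsigma1 (z : C) : V :=
  2%:R^-1 *: \sum_a cur_at (tnth I a) (-1) z (cur_at (tnth I a) (-1) z vac).

Definition varsigma2 (z : C) : V :=
  3%:R^-1 *: \sum_a \sum_b \sum_c tabc a b c *:
    cur_at (tnth I a) (-1) z
      (cur_at (tnth I b) (-1) z (cur_at (tnth I c) (-1) z vac)).

(* Only used for i = 1 and i = 2. *)
Definition varsigma (i : nat) : C -> V :=
  if i == 1%N then varsigma1 else varsigma2.

End GaudinStates.

(* Rational functions of (z, w) are ratios of elements of {poly {poly C}};    *)
(* z is the outer variable 'X and w the inner variable 'Y, so that u.[z, w]   *)
(* is the value at (z, w) and u.[z%:P] is u at fixed z, a polynomial in w.    *)
Section VectorValuedRationalFunctions.
Variables (C : fieldType) (V : lmodType C).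
Local Notation poly2 := {poly {poly C}}.

Definition deriv_z (u : poly2) : poly2 := u^`().
Definition deriv_w (u : poly2) : poly2 := map_poly (@deriv C) u.

Definition ratio_deriv (d : poly2 -> poly2) (f : {ratio poly2}) : {ratio poly2} :=
  Ratio (d \n_f * \d_f - \n_f * d \d_f) (\d_f ^+ 2).

(* The list of the (f, v) stands for the sum of the f(z, w) v. *)
Definition vrat := seq ({ratio poly2} * V).

Definition vrat_defined (F : vrat) (z w : C) : bool :=
  all (fun t => (\d_(t.1)).[z, w] != 0) F.

Definition vrat_eval (F : vrat) (z w : C) : V :=
  \sum_(t <- F) ((\n_(t.1)).[z, w] / (\d_(t.1)).[z, w]) *: t.2.

Definition vrat_deriv (d : poly2 -> poly2) (F : vrat) : vrat :=
  [seq (ratio_deriv d t.1, t.2) | t <- F].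

(* c is the Laurent expansion of w |-> f(z0, w) at w = z0: with x = w - z0,   *)
(* N(x) = \n_f(z0, z0 + x) and D(x) = \d_f(z0, z0 + x) <> 0, the Laurent      *)
(* series sum_n c_n x^n is the solution of D(x) * (sum_n c_n x^n) = N(x).     *)
Definition laurent_diag (f : {ratio poly2}) (z0 : C) (c : int -> C) : Prop :=
  let num := (\n_f).[z0%:P] \Po ('X + z0%:P) in
  let den := (\d_f).[z0%:P] \Po ('X + z0%:P) in
  [/\ den != 0,
      exists m : int, forall n, n < m -> c n = 0
    & forall n : int,
        \sum_(l < size den) den`_l * c (n - l%:Z) =
        if n is Posz m then num`_m else 0].

(* The coefficients of the expansion of F(z, w) in w about w = z are rational *)
(* in z, hence the restriction to generic z0: at finitely many z0 (such as    *)
(* the other poles of F(z, w) in w) the expansion of w |-> F(z0, w) is not    *)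
(* obtained by evaluating these coefficients at z0.                           *)
Definition regular_diag_mod (T : V -> V) (F : vrat) : Prop :=
  exists S : seq C, forall z0, z0 \notin S ->
    exists c : {ratio poly2} -> int -> C,
      (forall t, t \in F -> laurent_diag t.1 z0 (c t.1)) /\
      (forall n : int, n < 0 ->
         exists Z : V, \sum_(t <- F) c t.1 n *: t.2 = T Z).

End VectorValuedRationalFunctions.

Section TwistedDerivatives.
Variables (C : fieldType) (M N : nat) (V : lmodType C).
Variables (p k : 'I_N -> C).

Definition twist (z : C) : C := \sum_(i < N) k i / (z - p i).

Definition Dz (j : int) (F : vrat V) (z w : C) : V :=
  vrat_eval (vrat_deriv (@deriv_z C) F) z w
  - (j%:~R / M%:R * twist z) *: vrat_eval F z w.

Definition Dw (j : int) (F : vrat V) (z w : C) : V :=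
  vrat_eval (vrat_deriv (@deriv_w C) F) z w
  - (j%:~R / M%:R * twist w) *: vrat_eval F z w.

End TwistedDerivatives.

(* Main.v *)
From HB Require Import structures.
Require Import Defs.
From Stdlib Require Import BinInt.
From mathcomp Require Import all_boot all_order all_algebra.
From mathcomp Require Import reals complex.
From mathcomp Require Import ssrZ ring zify.

Set Implicit Arguments.
Unset Strict Implicit.
Unset Printing Implicit Defensive.

Import Order.TTheory GRing.Theory Num.Theory.
Local Open Scope ring_scope.
Local Open Scope complex_scope.

(** For a function F on the N sites write a_n[F] = sum_l F_l a_n^(l) and
    k[F] = sum_l k_l F_l.  With f_l = 1/(z - p_l), g_l = 1/(w - p_l) and
    c = 1/(z - w),

      a_n(z) = a_n[f],   a_n(w) = a_n[g],   phi(z) = k[f],   phi(w) = k[g],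
      [a_m[F], b_n[G]] = [a, b]_(m+n)[F G] - n delta_(m+n,0) (a|b) k[F G],
      f g = c (g - f),   d f / d z = - f^2,   d g / d w = - g^2,

    and the points p_l do not matter any further.  Summing over an orthonormal
    basis of sl_M amounts to summing over the matrix units J_ab, projected to
    sl_M.  All vectors of the theorem thus become words in the J_ab[F] applied to
    the vacuum, with the matrix indices contracted in pairs, and with
    coefficients in c, the k[F] and 1/M; the commutation relations bring such a
    word to a normal form without any reference to the size of M or N.

    Why potentials A exist.  In varsigma_i(z)_(0) varsigma_j(w), the central terms
    of the single contractions carry the factor k[f g] = - c (phi(z) - phi(w)).
    On the other side, phi(z) - phi(w) multiplies - (i j / M) A.  Comparing the
    terms of highest degree in the levels determines A modulo the image of T,
    first its part linear in the levels (from the double contractions, for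
    i = j = 2 only), then the rest:

      A_11 = M c I^a_(-2)[f] I^a_(-1)[g],
      A_12 = (M/2) c t_abc I^a_(-2)[f] I^b_(-1)[g] I^c_(-1)[g],
      A_21 = M c t_abc I^a_(-2)[f] I^b_(-1)[f] I^c_(-1)[g],
      A_22 = (M/2) c t_abe t_cde I^c_(-1)[g] I^b_(-1)[f] I^d_(-1)[g] I^a_(-2)[f]
             - (M^2 - 4)/3 c k[f g] I^a_(-3)[f] I^a_(-2)[g]
             - M (M^2 - 4)/3 c (2 I^a_(-3)[f] I^a_(-2)[f g^2]
                                + I^a_(-3)[f^2 g] I^a_(-2)[g]).

    That the remaining terms agree up to T B, with an explicit B, is an identity
    between normal forms, which is verified by computation on the syntax of words
    ([identities11] to [identities22]); [vanishes_sound] says that such a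
    computation is conclusive, [sem_zero_mode] that the zero mode is the
    expression computed with, and [rep_sem] that expressions are rational
    functions of z and w whose formal derivatives are those of the syntax.

    Regularity.  A = c G where G has no pole at w = z, so that the only polar
    coefficient of A is the value of - G there ([regular_simple_pole]).  This
    value is again an expression, obtained by putting g = f.  It is T Z for an
    explicit Z, because up to commutators it contracts a symmetric tensor with
    equal currents, one of which is differentiated. *)

(** * Words in the currents, and how they are rewritten *)

(** The label (a, b) stands for the function f^a g^b on the sites, where
    f_l = 1/(z - p_l) and g_l = 1/(w - p_l). *)
Definition label := (nat * nat)%type.
Definition mul_label (F G : label) : label := (F.1 + G.1, F.2 + G.2)%N.

(** [row] and [col] are names of summation variables. *)
Record letter := Letter { mode : int; lab : label; row : nat; col : nat }.

(** u^upow c^cpow (prod of the k[F], F in cens) (word in the letters), with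
    u = 1/M, c = 1/(z - w) and k[F] = sum_l k_l F_l.  Every monomial is summed
    over the same six variables, used or not; a contraction of two of them
    therefore costs a factor u, and no positive power of M ever occurs. *)
Record mono := Mono { upow : nat; cpow : nat; cens : seq label; letters : seq letter }.

Notation nvar := 6%N.

Definition expr := seq (Z * mono).

Definition scale (x : Z) (E : expr) : expr := [seq (x * t.1, t.2) | t <- E].
Definition sub_expr (E E' : expr) : expr := E ++ scale (-1) E'.

Definition with_letters (w : mono) ls := Mono (upow w) (cpow w) (cens w) ls.
Definition with_cens (w : mono) ks := Mono (upow w) (cpow w) ks (letters w).
Definition relabel (x : letter) F := Letter (mode x) F (row x) (col x).
Definition at_mode (x : letter) n := Letter n (lab x) (row x) (col x).
Definition rename_letter (r : nat -> nat) (x : letter) :=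
  Letter (mode x) (lab x) (r (row x)) (r (col x)).
Definition rename (r : nat -> nat) (ls : seq letter) := map (rename_letter r) ls.

Definition identify (j k x : nat) : nat := if x == k then j else x.

(** Eliminates the Kronecker deltas of the variables listed in [ds]; [s] is the
    substitution made so far, under which the rest of [ds] is to be read. *)
Fixpoint contract (s : nat -> nat) (ds : seq (nat * nat)) (w : mono) : mono :=
  if ds is d :: ds' then
    if s d.1 == s d.2 then contract s ds' w
    else let r := identify (s d.1) (s d.2) in
      contract (r \o s) ds'
        (Mono (upow w).+1 (cpow w) (cens w) (rename r (letters w)))
  else w.

(** The word [pre ++ x :: y :: suf], with x and y exchanged at the cost of their
    commutator. *)
Definition swap_terms (w : mono) (pre : seq letter) (x y : letter) (suf : seq letter)
    : expr :=
  let F := mul_label (lab x) (lab y) in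
  let n := mode x + mode y in
  let bracket i j := with_letters w (pre ++ Letter n F i j :: suf) in
  let central e := Mono (e + upow w)%N (cpow w) (F :: cens w) (pre ++ suf) in
  [:: (1, with_letters w (pre ++ y :: x :: suf));
      (1, contract id [:: (col x, row y)] (bracket (row x) (col y)));
      (-1, contract id [:: (row x, col y)] (bracket (row y) (col x)))] ++
  if n == 0 then
    [:: (- Z_of_int (mode y),
          contract id [:: (col x, row y); (row x, col y)] (central 0%N));
        (Z_of_int (mode y),
          contract id [:: (row x, col x); (row y, col y)] (central 1%N))]
  else [::].

Definition swap_at (w : mono) (n : nat) : option expr :=
  if drop n (letters w) is x :: y :: suf then
    Some (swap_terms w (take n (letters w)) x y suf)
  else None.

(** f^(a+1) g^(b+1) = c f^a g^(b+1) - c f^(a+1) g^b. *)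
Definition partial_fractions (F : label) : option (label * label) :=
  match F with
  | (S a, S b) => Some ((a, S b), (S a, b))
  | _ => None
  end.

Fixpoint find_map (A B : Type) (h : A -> option B) (s : seq A) : option (nat * B) :=
  if s is x :: s' then
    if h x is Some b then Some (0%N, b) else
    if find_map h s' is Some (n, b) then Some (n.+1, b) else None
  else None.

Definition set_at (A : Type) (s : seq A) n (x : A) := take n s ++ x :: drop n.+1 s.

(** Some letter J_ii has a variable i occurring nowhere else; the sum over i is
    the trace of J, which is 0. *)
Fixpoint has_trace (pre ls : seq letter) : bool :=
  if ls is x :: ls' then
    if (row x == col x) && all (fun y => (row y != row x) && (col y != row x)) (pre ++ ls')
    then true else has_trace (rcons pre x) ls'
  else false.

Fixpoint total (ls : seq letter) : int :=
  if ls is x :: ls' then mode x + total ls' else 0.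

(** Some final segment of the word is 0 because it has positive total mode, or
    because it is a single letter of mode at least 0. *)
Fixpoint kills_vacuum (ls : seq letter) : bool :=
  if ls is x :: ls' then
    if (0 < total ls) || (nilp ls' && (0 <= mode x)) then true else kills_vacuum ls'
  else false.

Definition bounded (ls : seq letter) : bool :=
  all (fun x => (row x < nvar)%N && (col x < nvar)%N) ls.

(* What follows, up to [step], only chooses which letters to exchange. *)

Fixpoint first_pair (A : Type) (r : rel A) (s : seq A) : option nat :=
  if s is x :: s' then
    if s' is y :: _ then
      if r x y then Some 0%N else omap S (first_pair r s')
    else None
  else None.

(** Injective in mode and label, for negative modes and exponents below 7. *)
Definition code (x : letter) : nat := (`|mode x| * 50 + (lab x).1 * 7 + (lab x).2)%N.

Definition row_order (ls : seq letter) : seq nat :=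
  rev (undup (rev (map row ls ++ iota 0 nvar))).

(** The contraction pattern of the word, independent of the names used. *)
Definition pattern (ls : seq letter) : seq nat :=
  let r := row_order ls in
  flatten [seq [:: index (row x) r; index (col x) r] | x <- ls].

Fixpoint lex_lt (s t : seq nat) : bool :=
  match s, t with
  | x :: s', y :: t' => if x == y then lex_lt s' t' else (x < y)%N
  | _, _ => false
  end.

Definition letter0 := Letter 0 (0, 0)%N 0 0.

(** Equal letters of a sorted word still do not commute: among the arrangements
    permuting equal letters, the one with the least pattern is aimed at. *)
Definition best_arrangement (ls : seq letter) : seq nat :=
  let n := size ls in
  let cs := map code ls in
  let pat p := pattern [seq nth letter0 ls i | i <- p] in
  (foldl (fun b p => let q := pat p in if lex_lt q b.2 then (p, q) else b)
     (iota 0 n, pattern ls)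
     [seq p <- permutations (iota 0 n) | map (nth 0%N cs) p == cs]).1.

Definition choose_swap (ls : seq letter) : option nat :=
  if first_pair (fun x y => code x < code y)%N ls is Some n then Some n else
  let t := best_arrangement ls in
  first_pair (fun i j => j < i)%N [seq index i t | i <- iota 0 (size ls)].

(** One rewriting step, [None] on normal words. *)
Definition step (w : mono) : option expr :=
  if ~~ bounded (letters w) then None else
  if kills_vacuum (letters w) || has_trace [::] (letters w) then Some [::] else
  if first_pair (fun x y => (0 <= mode x) && (mode y < 0)) (letters w) is Some n
  then swap_at w n else
  let split F1 F2 (w' : label -> mono) := Some [:: (1, w' F1); (-1, w' F2)] in
  let w1 := Mono (upow w) (cpow w).+1 (cens w) (letters w) in
  if find_map partial_fractions (cens w) is Some (n, (F1, F2)) then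
    split F1 F2 (fun F => with_cens w1 (set_at (cens w) n F))
  else if find_map (fun x => partial_fractions (lab x)) (letters w) is Some (n, (F1, F2)) then
    let x := nth letter0 (letters w) n in
    split F1 F2 (fun F => with_letters w1 (set_at (letters w) n (relabel x F)))
  else if choose_swap (letters w) is Some n then swap_at w n else None.

Definition leq_label (F G : label) := (F.1 < G.1)%N || ((F.1 == G.1) && (F.2 <= G.2)%N).

(** A representative under renaming of variables and reordering of the k[F]. *)
Definition tidy (w : mono) : mono :=
  let r := row_order (letters w) in
  Mono (upow w) (cpow w) (sort leq_label (cens w))
    (if bounded (letters w) && perm_eq r (iota 0 nvar)
     then rename (fun i => index i r) (letters w) else letters w).

(* Nested conditionals rather than conjunctions: the latter would be evaluated
   entirely in a call-by-value reduction. *)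
Definition eq_letter (x y : letter) : bool :=
  if mode x == mode y then if lab x == lab y then
  if row x == row y then col x == col y else false else false else false.
Fixpoint eq_letters (s t : seq letter) : bool :=
  match s, t with
  | [::], [::] => true
  | x :: s', y :: t' => if eq_letter x y then eq_letters s' t' else false
  | _, _ => false
  end.
Definition eq_mono (v w : mono) : bool :=
  if upow v == upow w then if cpow v == cpow w then
  if eq_letters (letters v) (letters w) then cens v == cens w
  else false else false else false.

Fixpoint insert (t : Z * mono) (E : expr) : expr :=
  if E is t' :: E' then
    if eq_mono t.2 t'.2 then
      let x := t.1 + t'.1 in if x == 0 then E' else (x, t'.2) :: E'
    else t' :: insert t E'
  else if t.1 == 0 then [::] else [:: t].

(** One step on every word; collecting equal words in between keeps the number of
    words below about a thousand. *)
Definition sweep (E : expr) : expr :=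
  foldl (fun acc t =>
    if step t.2 is Some E' then
      foldl (fun acc' s => insert (t.1 * s.1, tidy s.2) acc') acc E'
    else insert (t.1, tidy t.2) acc) [::] E.

(** 40 steps are more than the normalization of the words at hand takes. *)
Definition vanishes (E : expr) : bool := nilp (iter 40 sweep E).

(** * Formal derivations, zero modes and twisted derivatives *)

(** The derivatives of f and g are - f^2 and - g^2. *)
Definition dlabel (in_w : bool) (F : label) : Z * label :=
  if in_w then (- Z_of_int F.2%:Z, (F.1, F.2.+1)) else (- Z_of_int F.1%:Z, (F.1.+1, F.2)).

Fixpoint leibniz (A : Type) (d : A -> Z * A) (s : seq A) : seq (Z * seq A) :=
  if s is x :: s' then
    ((d x).1, (d x).2 :: s') :: [seq (t.1, x :: t.2) | t <- leibniz d s']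
  else [::].

Definition dletter (in_w : bool) (x : letter) : Z * letter :=
  ((dlabel in_w (lab x)).1, relabel x (dlabel in_w (lab x)).2).

Definition dmono (in_w : bool) (w : mono) : expr :=
  ((if in_w then Z_of_int (cpow w)%:Z else - Z_of_int (cpow w)%:Z),
    Mono (upow w) (cpow w).+1 (cens w) (letters w)) ::
  [seq (t.1, with_cens w t.2) | t <- leibniz (dlabel in_w) (cens w)] ++
  [seq (t.1, with_letters w t.2) | t <- leibniz (dletter in_w) (letters w)].

Definition Tletter (x : letter) : Z * letter := (- Z_of_int (mode x), at_mode x (mode x - 1)).
Definition Tmono (w : mono) : expr :=
  [seq (t.1, with_letters w t.2) | t <- leibniz Tletter (letters w)].

Definition extend (h : mono -> expr) (E : expr) : expr :=
  flatten [seq scale t.1 (h t.2) | t <- E].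
Definition dexpr in_w := extend (dmono in_w).
Definition Texpr := extend Tmono.

Definition cmul (E : expr) : expr :=
  [seq (t.1, Mono (upow t.2) (cpow t.2).+1 (cens t.2) (letters t.2)) | t <- E].
(** Multiplication by k[F]/M. *)
Definition kmul (F : label) (E : expr) : expr :=
  [seq (t.1, Mono (upow t.2).+1 (cpow t.2) (F :: cens t.2) (letters t.2)) | t <- E].

(** j D_z^(i) - i D_w^(j), since the twist functions are k[f] and k[g]. *)
Definition Dexpr (i j : nat) (A : expr) : expr :=
  let ij := Z_of_int (i * j)%N%:Z in
  scale (Z_of_int j%:Z) (dexpr false A) ++ scale (- Z_of_int i%:Z) (dexpr true A) ++
  scale (- ij) (kmul (1, 0)%N A) ++ scale ij (kmul (0, 1)%N A).

(** The words of X_(m) ls, where X is the state xs|0> and all letters of xs have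
    mode -1, by the normal ordered product formula, whose infinite sums are cut
    off after L terms. *)
Fixpoint modes (L : nat) (xs : seq letter) (m : int) (ls : seq letter) : seq (seq letter) :=
  if xs is x :: xs' then
    if xs' is [::] then [:: at_mode x m :: ls] else
    flatten [seq [seq at_mode x (- l.+1%:Z) :: t | t <- modes L xs' (m + l%:Z) ls] ++
                 modes L xs' (m - l%:Z - 1) (at_mode x l%:Z :: ls) | l <- iota 0 L]
  else [::].

Arguments modes : simpl never.

Definition state_letter (F : label) (ij : nat * nat) := Letter (-1) F ij.1 ij.2.

Definition cyc2 : seq (nat * nat) := [:: (0, 1); (1, 0)]%N.
Definition cyc3 : seq (nat * nat) := [:: (0, 1); (1, 2); (2, 0)]%N.
Definition cyc3' : seq (nat * nat) := [:: (0, 2); (1, 0); (2, 1)]%N.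

(** Up to a scalar, the contraction patterns of the quadratic (i = 1) and the
    cubic (i = 2) state. *)
Definition state_cycles (i : nat) : seq (seq (nat * nat)) :=
  if i == 1%N then [:: cyc2] else [:: cyc3; cyc3'].
Definition shift_cycle (d : nat) (s : seq (nat * nat)) := [seq (d + x.1, d + x.2)%N | x <- s].

(** 1/2 and 1/3 in units of 1/72, in which the coefficients of all expressions are
    counted. *)
Definition state_coef (i : nat) : Z := if i == 1%N then 36 else 24.

(** The two states use the variables 0, 1, 2 and 3, 4, 5; the cut-off 5 suffices
    on words of total mode at least -3. *)
Definition zero_mode (i j : nat) : expr :=
  flatten [seq flatten [seq
      [seq (Z.div (state_coef i * state_coef j) 72, Mono (4 - (i + j))%N 0 [::] ls)
       | ls <- modes 5 (map (state_letter (1, 0)%N) (shift_cycle 0 s)) 0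
                 (map (state_letter (0, 1)%N) (shift_cycle 3 t))]
    | t <- state_cycles j] | s <- state_cycles i].

Definition diag_label (F : label) : label := (F.1 + F.2, 0)%N.
Definition diag_letter (x : letter) := relabel x (diag_label (lab x)).
(** Restriction to w = z, of expressions without c. *)
Definition diag (E : expr) : expr :=
  [seq (t.1, with_letters (with_cens t.2 (map diag_label (cens t.2)))
                (map diag_letter (letters t.2))) | t <- E].

(** * The potentials *)

(** A current of mode -n and label f^a g^b. *)
Local Notation "''J_' n [ a , b ]" := ((- n%N%:Z : int), (a%N, b%N))
  (at level 8, n at level 2, format "''J_' n [ a , b ]").

(** (x / 72) M^(3 - e) c^n k[ks] times the word with letters [ls] and indices
    [ix].  The word has size ls variables, so the sum over the six variables has
    6 - size ls factors M in excess. *)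
Definition term (x : Z) (e n : nat) (ks : seq label) (ls : seq (int * label))
    (ix : seq (nat * nat)) : Z * mono :=
  (x, Mono (3 + e - size ls)%N n ks
        [seq Letter t.1.1 t.1.2 t.2.1 t.2.2 | t <- zip ls ix]).

Definition quadratic x e n ks (a b : int * label) : expr :=
  [:: term x e n ks [:: a; b] cyc2].

(** t_abc I^a I^b I^c *)
Definition cubic x e n (a b d : int * label) : expr :=
  [:: term x e n [::] [:: a; b; d] cyc3; term x e n [::] [:: a; b; d] cyc3'].

(** (x / 72) M c^n t_abe t_cde times a product of four currents, those at the
    positions p, q carrying the indices a, b and those at r, s carrying c, d.  By
    completeness of the matrix units, t_abe t_cde is the sum of tr(I_a I_b I_c I_d)
    over the exchanges of a with b and of c with d, minus
    (4/M) tr(I_a I_b) tr(I_c I_d). *)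
Definition quartic x n (p q r s : nat) (ls : seq (int * label)) : expr :=
  let along c := [seq (t, next c t) | t <- iota 0 4] in
  let pairs := [seq (t, next (if t \in [:: p; q] then [:: p; q] else [:: r; s]) t) | t <- iota 0 4] in
  [seq term x 2 n [::] ls (along c)
     | c <- [:: [:: p; q; r; s]; [:: q; p; r; s]; [:: p; q; s; r]; [:: q; p; s; r]]] ++
  [:: term (- 4%:R * x) 3 n [::] ls pairs].

(** Multiples of (x / 72) (M^2 - 4) M^(1 - e). *)
Definition mu_term x e n ks ls ix : expr :=
  [:: term x e n ks ls ix; term (- 4%:R * x) e.+2 n ks ls ix].
Definition mu_quad x e n ks (a b : int * label) := mu_term x e n ks [:: a; b] cyc2.
(** The structure constants in place of t_abc. *)
Definition mu_alt x e n ks (a b d : int * label) :=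
  mu_term x e n ks [:: a; b; d] cyc3 ++ mu_term (- x) e n ks [:: a; b; d] cyc3'.

(** A_ij = c G_ij, and Z_ij is a primitive of the restriction of G_ij to w = z. *)
Definition G11 : expr := quadratic 72 2 0 [::] 'J_2[1,0] 'J_1[0,1].
Definition B11 : expr := quadratic 72 2 2 [::] 'J_1[1,0] 'J_1[0,1].
Definition Z11 : expr := quadratic 36 2 0 [::] 'J_1[1,0] 'J_1[1,0].

Definition G12 : expr := cubic 36 2 0 'J_2[1,0] 'J_1[0,1] 'J_1[0,1].
Definition B12 : expr := cubic 36 2 2 'J_1[1,0] 'J_1[0,1] 'J_1[0,1].
Definition Z12 : expr := cubic 12 2 0 'J_1[1,0] 'J_1[1,0] 'J_1[1,0].

Definition G21 : expr := cubic 72 2 0 'J_2[1,0] 'J_1[1,0] 'J_1[0,1].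
Definition B21 : expr := cubic 72 2 2 'J_1[1,0] 'J_1[1,0] 'J_1[0,1].
Definition Z21 : expr := cubic 24 2 0 'J_1[1,0] 'J_1[1,0] 'J_1[1,0].

Definition G22 : expr :=
  quartic 36 0 0 2 1 3 [:: 'J_1[0,1]; 'J_1[1,0]; 'J_1[0,1]; 'J_2[1,0]] ++
  mu_quad (-24) 1 0 [:: (1, 1)%N] 'J_3[1,0] 'J_2[0,1] ++
  mu_quad (-48) 0 0 [::] 'J_3[1,0] 'J_2[1,2] ++
  mu_quad (-24) 0 0 [::] 'J_3[2,1] 'J_2[0,1].

(** The coefficients solve the linear system saying that what remains of the zero
    mode is T of a combination of words; the mixed labels only shorten the list. *)
Definition B22 : expr :=
  quartic 36 2 0 1 2 3 [:: 'J_1[0,1]; 'J_1[0,1]; 'J_1[1,0]; 'J_1[1,0]] ++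
  mu_alt 72 1 1 [::] 'J_2[0,1] 'J_1[0,1] 'J_1[2,1] ++
  mu_alt 72 1 1 [::] 'J_2[0,1] 'J_1[1,2] 'J_1[1,0] ++
  mu_alt 72 1 2 [::] 'J_2[0,2] 'J_1[0,1] 'J_1[1,0] ++
  mu_alt 144 2 1 [:: (1, 1)%N] 'J_2[0,1] 'J_1[0,1] 'J_1[1,0] ++
  mu_quad 96 2 0 [:: (1, 1); (1, 1)]%N 'J_1[0,1] 'J_3[1,0] ++
  mu_quad 72 1 0 [:: (1, 1)%N] 'J_2[1,0] 'J_2[1,2] ++
  mu_quad (-168) 1 1 [:: (1, 1)%N] 'J_2[0,1] 'J_2[1,1] ++
  mu_quad 144 1 0 [:: (1, 1)%N] 'J_3[2,1] 'J_1[0,1] ++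
  mu_quad 96 1 1 [:: (1, 1)%N] 'J_3[1,0] 'J_1[0,2] ++
  mu_quad 48 1 0 [:: (2, 2)%N] 'J_3[1,0] 'J_1[0,1] ++
  mu_quad (-24) 1 2 [:: (1, 1)%N] 'J_2[1,0] 'J_2[1,0] ++
  mu_quad 48 1 1 [:: (1, 1)%N] 'J_3[0,1] 'J_1[1,1] ++
  mu_quad (-144) 1 0 [:: (1, 1)%N] 'J_1[1,0] 'J_3[1,2] ++
  mu_quad (-144) 1 1 [:: (1, 1)%N] 'J_3[1,0] 'J_1[1,1] ++
  mu_quad 288 0 1 [::] 'J_1[0,1] 'J_3[2,2] ++
  mu_quad (-72) 0 1 [::] 'J_1[2,2] 'J_3[0,1] ++
  mu_quad (-192) 0 1 [::] 'J_3[0,2] 'J_1[2,1] ++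
  mu_quad (-96) 0 1 [::] 'J_2[1,0] 'J_2[2,2] ++
  mu_quad (-48) 0 2 [::] 'J_2[1,0] 'J_2[2,1] ++
  mu_quad (-360) 0 2 [::] 'J_2[0,1] 'J_2[1,2] ++
  mu_quad (-72) 0 2 [::] 'J_1[0,2] 'J_3[2,0] ++
  mu_quad 120 0 3 [::] 'J_2[0,1] 'J_2[0,2] ++
  mu_quad (-192) 0 3 [::] 'J_1[0,2] 'J_3[1,0] ++
  mu_quad 96 0 2 [::] 'J_3[3,0] 'J_1[0,1] ++
  mu_quad 168 0 3 [::] 'J_3[0,1] 'J_1[0,2] ++
  mu_quad (-36) 0 2 [::] 'J_2[0,2] 'J_2[2,0] ++
  mu_quad (-144) 0 2 [::] 'J_1[1,0] 'J_3[0,3] ++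
  mu_quad 48 0 2 [::] 'J_1[0,3] 'J_3[1,0] ++
  mu_quad 24 0 3 [::] 'J_1[2,0] 'J_3[0,1] ++
  mu_quad (-120) 0 3 [::] 'J_2[0,1] 'J_2[2,0] ++
  mu_quad (-120) 0 2 [::] 'J_1[2,0] 'J_3[0,2] ++
  mu_quad 72 0 2 [::] 'J_2[0,3] 'J_2[1,0].

Definition Z22 : expr :=
  quartic 9 0 0 1 2 3 [:: 'J_1[1,0]; 'J_1[1,0]; 'J_1[1,0]; 'J_1[1,0]] ++
  mu_quad (-12) 0 0 [::] 'J_3[3,0] 'J_1[1,0] ++
  mu_quad (-24) 0 0 [::] 'J_2[1,0] 'J_2[3,0] ++
  mu_quad 9 0 0 [::] 'J_2[2,0] 'J_2[2,0] ++
  mu_quad (-6) 1 0 [:: (2, 0)%N] 'J_2[1,0] 'J_2[1,0].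

Definition zero_mode_identity (i j : nat) (G B : expr) : bool :=
  vanishes (sub_expr (sub_expr (zero_mode i j) (Dexpr i j (cmul G))) (Texpr B)).
Definition diag_identity (G Z : expr) : bool :=
  vanishes (sub_expr (diag G) (Texpr Z)).

Lemma identities11 : zero_mode_identity 1 1 G11 B11 && diag_identity G11 Z11.
Proof. by vm_cast_no_check (erefl true). Qed.
Lemma identities12 : zero_mode_identity 1 2 G12 B12 && diag_identity G12 Z12.
Proof. by vm_cast_no_check (erefl true). Qed.
Lemma identities21 : zero_mode_identity 2 1 G21 B21 && diag_identity G21 Z21.
Proof. by vm_cast_no_check (erefl true). Qed.
Lemma identities22 : zero_mode_identity 2 2 G22 B22 && diag_identity G22 Z22.
Proof. by vm_cast_no_check (erefl true). Qed.

(** * The current algebra in terms of matrix units *)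

Section Semantics.
Variables (C : numFieldType) (M N : nat) (V : lmodType C).
Variables (rho : affineRep M N V) (k : 'I_N -> C) (vac : V).
Hypothesis M_gt0 : (0 < M)%N.
Hypothesis vacP : vacuum_like rho k vac.

Let u : C := M%:R^-1.

Lemma M_neq0 : M%:R != 0 :> C.
Proof. by rewrite pnatr_eq0 -lt0n. Qed.

(** The projections of the matrix units to sl_M: they have the commutators of the
    matrix units, because the kernel of the projection is central. *)
Definition eunit (a b : 'I_M) : 'M[C]_M := delta_mx a b - (u * (a == b)%:R)%:M.

Lemma tr_delta (a b : 'I_M) : \tr (delta_mx a b : 'M[C]_M) = (a == b)%:R.
Proof.
rewrite /mxtrace (bigD1 a) //= mxE eqxx andTb big1 ?addr0 // => i ia.
by rewrite mxE (negPf ia).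
Qed.

Lemma eunit_sl a b : eunit a b \in sl C M.
Proof.
rewrite mem_sl /eunit linearB /= tr_delta mxtrace_scalar -[X in _ - X]mulr_natr mulrAC.
by rewrite /u mulVf ?M_neq0 // mul1r subrr.
Qed.

Lemma tr_mul_eunit a b c d :
  \tr (eunit a b *m eunit c d) =
  (b == c)%:R * (a == d)%:R - u * ((a == b)%:R * (c == d)%:R).
Proof.
rewrite /eunit mulmxBl !mulmxBr mul_mx_scalar !mul_scalar_mx mul_delta_mx_cond.
rewrite !linearB /= !linearZ /= mxtrace_scalar !tr_delta raddfMn /= tr_delta.
rewrite -[X in X - _ - _]mulr_natl.
have -> : u * (c == d)%:R *+ M = (c == d)%:R.
  by rewrite -(mulr_natr _ M) mulrAC /u mulVf ?M_neq0 ?mul1r.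
by ring.
Qed.

Lemma commutator_eunit a b c d :
  eunit a b *m eunit c d - eunit c d *m eunit a b =
  (b == c)%:R *: eunit a d - (a == d)%:R *: eunit c b.
Proof.
have deltaM : delta_mx a b *m delta_mx c d - delta_mx c d *m delta_mx a b =
    (b == c)%:R *: delta_mx a d - (a == d)%:R *: delta_mx c b :> 'M[C]_M.
  by rewrite !mul_delta_mx_cond !scaler_nat (eq_sym d).
have -> : eunit a b *m eunit c d - eunit c d *m eunit a b =
    delta_mx a b *m delta_mx c d - delta_mx c d *m delta_mx a b.
  rewrite /eunit !mulmxBl !mulmxBr !mul_mx_scalar !mul_scalar_mx !scale_scalar_mx.
  move: (_ *m _) (_ *m _) => X Y.
  by apply/matrixP => i j; rewrite !mxE; ring.
rewrite deltaM /eunit !scalerBr !scale_scalar_mx.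
suff -> : (b == c)%:R * (u * (a == d)%:R) = (a == d)%:R * (u * (c == b)%:R) :> C.
  by move: (_ * _)%:M => Z; apply/matrixP => i j; rewrite !mxE; ring.
by rewrite (eq_sym c); ring.
Qed.

Lemma cur0 i n v : cur rho i 0 n v = 0.
Proof.
have := cur_linear rho i n (-1) v (mem0v _) (mem0v _).
by rewrite scaler0 addr0 scaleN1r addNr.
Qed.
Lemma curD i n a b v : a \in sl C M -> b \in sl C M ->
  cur rho i (a + b) n v = cur rho i a n v + cur rho i b n v.
Proof. by move=> ha hb; rewrite -[a]scale1r cur_linear // !scale1r. Qed.
Lemma curZ i n x a v : a \in sl C M -> cur rho i (x *: a) n v = x *: cur rho i a n v.
Proof. by move=> ha; rewrite -[_ *: a]addr0 cur_linear ?mem0v // cur0 addr0. Qed.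

Lemma curB i n x y a b v : a \in sl C M -> b \in sl C M ->
  cur rho i (x *: a - y *: b) n v = x *: cur rho i a n v - y *: cur rho i b n v.
Proof. by move=> ha hb; rewrite -scaleNr curD ?rpredZ // !curZ // scaleNr. Qed.

Section AtPoint.
Variables f g : 'I_N -> C.

Definition label_at (F : label) (l : 'I_N) : C := f l ^+ F.1 * g l ^+ F.2.
Definition level_at (F : label) : C := \sum_l label_at F l * k l.

Lemma label_at_mul F G l : label_at (mul_label F G) l = label_at F l * label_at G l.
Proof. by rewrite /label_at /= !exprD mulrACA. Qed.

Definition current (n : int) (F : label) (a b : 'I_M) (v : V) : V :=
  \sum_l label_at F l *: cur rho l (eunit a b) n v.

Lemma current_is_linear n F a b : linear (current n F a b).
Proof.
move=> x v w; rewrite /current scaler_sumr -big_split /=; apply: eq_bigr => l _.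
by rewrite linearP scalerDr !scalerA mulrC.
Qed.
HB.instance Definition _ n F a b :=
  GRing.isLinear.Build C V V _ (current n F a b) (current_is_linear n F a b).

Lemma current_vac (n : nat) F a b : current n%:Z F a b vac = 0.
Proof.
by rewrite /current big1 // => l _; rewrite (proj1 vacP) ?scaler0 ?eunit_sl.
Qed.

Lemma current_trace n F v : \sum_a current n F a a v = 0.
Proof.
rewrite /current exchange_big big1 //= => l _; rewrite -scaler_sumr.
have sumE : forall s : seq 'I_M, \sum_(a <- s) cur rho l (eunit a a) n v =
    cur rho l (\sum_(a <- s) eunit a a) n v.
  elim=> [|a s IH]; rewrite ?big_nil ?cur0 // !big_cons IH [RHS]curD ?eunit_sl //.
  by apply: rpred_sum => b _; apply: eunit_sl.
rewrite sumE big_split /= -mx1_sum_delta sumrN; set X := \sum_ _ _.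
suff -> : X = 1%:M by rewrite subrr cur0 scaler0.
rewrite /X; under eq_bigr do rewrite eqxx mulr1.
by rewrite sumr_const cardT size_enum_ord -raddfMn -mulr_natr mulVf ?M_neq0.
Qed.

(** Currents at different sites commute, so only the product of the two labels
    enters the commutator. *)
Lemma current_comm m n F G a b a' b' v :
  current m F a b (current n G a' b' v) =
  current n G a' b' (current m F a b v)
  + (b == a')%:R *: current (m + n) (mul_label F G) a b' v
  - (a == b')%:R *: current (m + n) (mul_label F G) a' b v
  - (if m + n == 0 then
       (n%:~R * ((b == a')%:R * (a == b')%:R - u * ((a == b)%:R * (a' == b')%:R)))
         *: \sum_l label_at (mul_label F G) l *: cen rho l v
     else 0).
Proof.
set s := (if _ then _ else _).
rewrite -!addrA addrC; apply/eqP; rewrite -subr_eq !addrA; apply/eqP.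
have opop p F1 a1 b1 q F2 a2 b2 : current p F1 a1 b1 (current q F2 a2 b2 v) =
    \sum_l \sum_l' (label_at F1 l * label_at F2 l') *:
      cur rho l (eunit a1 b1) p (cur rho l' (eunit a2 b2) q v).
  rewrite {1}/current; apply: eq_bigr => l _; rewrite linear_sum scaler_sumr.
  by apply: eq_bigr => l' _; rewrite linearZ scalerA.
rewrite !opop [X in _ - X]exchange_big -sumrB /=.
transitivity (\sum_l (label_at F l * label_at G l) *:
   (cur rho l (eunit a b *m eunit a' b' - eunit a' b' *m eunit a b) (m + n) v
     - (if m + n == 0 then (n%:~R * \tr (eunit a b *m eunit a' b')) *: cen rho l v else 0))).
  apply: eq_bigr => l _; rewrite -sumrB (bigD1 l) //= big1 ?addr0.
    by rewrite (mulrC (label_at G l)) -scalerBr cur_bracket ?eunit_sl // eqxx.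
  move=> l' /negPf ll'; rewrite (mulrC (label_at G l')) -scalerBr cur_bracket ?eunit_sl //.
  by rewrite eq_sym ll' scaler0.
under eq_bigr do rewrite commutator_eunit curB ?eunit_sl // !scalerBr -label_at_mul.
rewrite !sumrB /current !scaler_sumr; congr (_ - _ - _).
- by apply: eq_bigr => l _; rewrite !scalerA mulrC.
- by apply: eq_bigr => l _; rewrite !scalerA mulrC.
- rewrite /s; case: ifP => _; last by rewrite big1 // => l _; rewrite scaler0.
  rewrite scaler_sumr; apply: eq_bigr => l _.
  by rewrite tr_mul_eunit !scalerA mulrC.
Qed.

End AtPoint.
End Semantics.

(** * The vector of a word *)

Section Words.
Variables (C : numFieldType) (M N : nat) (V : lmodType C).
Variables (rho : affineRep M N V) (k : 'I_N -> C) (vac : V).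
Hypothesis M_gt0 : (0 < M)%N.
Hypothesis vacP : vacuum_like rho k vac.
Variables f g : 'I_N -> C.

Local Notation u := (M%:R^-1 : C).
Local Notation op := (current rho f g).
Local Notation kap := (level_at k f g).

Definition act (e : nat -> 'I_M) (ls : seq letter) (v : V) : V :=
  foldr (fun x => op (mode x) (lab x) (e (row x)) (e (col x))) v ls.

Definition word (e : nat -> 'I_M) (ls : seq letter) : V := act e ls vac.
Arguments word : simpl never.

Lemma act_is_linear e ls : linear (act e ls).
Proof. by move=> x v w; elim: ls => //= a ls ->; rewrite linearP. Qed.
HB.instance Definition _ e ls :=
  GRing.isLinear.Build C V V _ (act e ls) (act_is_linear e ls).

Lemma word_cat e ls ls' : word e (ls ++ ls') = act e ls (word e ls').
Proof. exact: foldr_cat. Qed.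

Lemma word_cons e x ls :
  word e (x :: ls) = op (mode x) (lab x) (e (row x)) (e (col x)) (word e ls).
Proof. by []. Qed.

Lemma word_rename e r ls : word e (rename r ls) = word (e \o r) ls.
Proof. by elim: ls => // x ls IH; rewrite [RHS]word_cons -IH. Qed.

Lemma cen_word l e ls : cen rho l (word e ls) = k l *: word e ls.
Proof.
elim: ls => [|x ls IH]; first exact: (proj2 vacP).
rewrite word_cons /current linear_sum scaler_sumr; apply: eq_bigr => l' _.
by rewrite linearZ /= cen_cur ?eunit_sl // IH linearZ /= !scalerA mulrC.
Qed.

Lemma word_swap e pre x y suf :
  let F := mul_label (lab x) (lab y) in
  let n := mode x + mode y in
  let r := e (row x) in let s := e (col x) in
  let r' := e (row y) in let s' := e (col y) in
  word e (pre ++ x :: y :: suf) =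
  word e (pre ++ y :: x :: suf)
  + (s == r')%:R *: word e (pre ++ Letter n F (row x) (col y) :: suf)
  - (r == s')%:R *: word e (pre ++ Letter n F (row y) (col x) :: suf)
  - (if n == 0 then
       ((mode y)%:~R * ((s == r')%:R * (r == s')%:R - u * ((r == s)%:R * (r' == s')%:R))
          * kap F) *: word e (pre ++ suf)
     else 0).
Proof.
move=> F n r s r' s'; rewrite !word_cat !word_cons current_comm //.
have -> : \sum_l label_at f g F l *: cen rho l (word e suf) = kap F *: word e suf.
  by rewrite scaler_suml; apply: eq_bigr => l _; rewrite cen_word scalerA.
rewrite scalerA !linearB linearD !linearZ /=.
by congr (_ - _); case: ifP => _; rewrite ?linearZ ?linear0.
Qed.

Lemma total_cat ls ls' : total (ls ++ ls') = total ls + total ls'.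
Proof. by elim: ls => [|x ls IH] /=; rewrite ?add0r // IH addrA. Qed.

Lemma word_nonneg_last e pre x : 0 <= mode x -> word e (rcons pre x) = 0.
Proof.
rewrite -cats1 word_cat word_cons; case: (mode x) => // n _.
by rewrite (current_vac M_gt0 vacP) linear0.
Qed.

(** The vacuum module has no vectors below the vacuum: moving a letter of
    non-negative mode to the right keeps the total mode and shortens the
    commutator terms. *)
Lemma word_total_gt0 e ls : 0 < total ls -> word e ls = 0.
Proof.
have [n] := ubnP (size ls); elim: n ls => // n IHn ls sz_ls ls_gt0.
have moveR suf : forall pre x, 0 <= mode x -> (size (pre ++ x :: suf) < n.+1)%N ->
    0 < total (pre ++ x :: suf) -> word e (pre ++ x :: suf) = 0.
  elim: suf => [|y suf IHsuf] pre x x_ge0 sz tot_gt0.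
    by rewrite cats1 word_nonneg_last.
  rewrite word_swap; move: sz tot_gt0; rewrite !size_cat !total_cat /= => sz tot_gt0.
  rewrite -cat_rcons IHsuf ?cat_rcons ?size_cat ?total_cat //=; try lia.
  rewrite !(IHn (pre ++ Letter _ _ _ _ :: _)) ?size_cat ?total_cat //=; try lia.
  rewrite !scaler0 addr0 subr0 sub0r; case: ifP => [/eqP n0|_]; last by rewrite oppr0.
  by rewrite IHn ?scaler0 ?oppr0 ?size_cat ?total_cat //; lia.
have [pre [x [suf [ls_eq x_ge0]]]] : exists pre x suf, ls = pre ++ x :: suf /\ 0 <= mode x.
  elim: ls {sz_ls} ls_gt0 => // x ls IH /= tot_gt0.
  have [x_ge0|x_lt0] := leP 0 (mode x); first by exists [::], x, ls.
  have [|pre [y [suf [-> y_ge0]]]] := IH; last by exists (x :: pre), y, suf.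
  by lia.
by rewrite ls_eq; apply: moveR; rewrite -?ls_eq.
Qed.

(** * Summation over the variables *)

Local Notation env := {ffun 'I_nvar -> 'I_M}.
Definition value (e : env) (i : nat) : 'I_M := e (inord i).
Definition upd (e : env) (i : nat) (a : 'I_M) : env :=
  [ffun j : 'I_nvar => if j == i :> nat then a else e j].

Lemma value_upd e i a j : (i < nvar)%N -> (j < nvar)%N ->
  value (upd e i a) j = if j == i then a else value e j.
Proof. by move=> i6 j6; rewrite /value ffunE inordK. Qed.

(** Resampling one variable: the sum over its new values is compensated by the
    factor u for its old values, which are forgotten. *)
Lemma sum_upd (W : lmodType C) i (Z : env -> W) : (i < nvar)%N ->
  \sum_e Z e = u *: \sum_e \sum_a Z (upd e i a).
Proof.
move=> i6.
(* [h] exchanges the new and the old value of the variable. *)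
pose h (t : env * 'I_M) := (upd t.1 i t.2, value t.1 i).
have hK : involutive h.
  case=> e a; congr pair; last by rewrite value_upd // eqxx.
  apply/ffunP => j; rewrite !ffunE /=; case: eqP => // ji.
  by rewrite /value -ji inord_val.
have -> : \sum_e \sum_a Z (upd e i a) = \sum_(t : env * 'I_M) Z t.1.
  rewrite pair_big (reindex_inj (inv_inj hK)); apply: eq_bigr => t _ /=.
  by rewrite -[upd _ _ _]/((h (h t)).1) hK.
rewrite -(pair_big xpredT xpredT (fun e a => Z e)) /= scaler_sumr; apply: eq_bigr => e _.
by rewrite sumr_const card_ord -scaler_nat scalerA mulVf ?scale1r // M_neq0.
Qed.

Lemma sum_identify (W : lmodType C) i j (X : (nat -> 'I_M) -> W) :
  (forall e e', {in gtn nvar, e =1 e'} -> X e = X e') ->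
  (i < nvar)%N -> (j < nvar)%N -> i != j ->
  \sum_e (value e i == value e j)%:R *: X (value e) =
  u *: \sum_e X (value e \o identify i j).
Proof.
move=> Xext i6 j6 ij.
rewrite [LHS](sum_upd _ j6); congr (_ *: _); apply: eq_bigr => e _.
rewrite (bigD1 (value e i)) //= big1 ?addr0.
  rewrite !value_upd // eqxx (negPf ij) eqxx scale1r; apply: Xext => l l6.
  by rewrite value_upd // /identify /=; case: (l == j).
by move=> a ai; rewrite !value_upd // eqxx (negPf ij) eq_sym (negPf ai) scale0r.
Qed.

Lemma eq_word e e' ls : bounded ls -> {in gtn nvar, e =1 e'} -> word e ls = word e' ls.
Proof.
move=> + ee'; elim: ls => // x ls IH /= /andP[/andP[r6 c6] /IH lsE].
by rewrite !word_cons lsE !ee'.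
Qed.

(** * The vector of an expression *)

Variable c : C.
Hypothesis fg : forall l, f l * g l = c * (g l - f l).

Definition zC (x : Z) : C := (int_of_Z x)%:~R.

Lemma zCD : {morph zC : x y / x + y}. Proof. by move=> x y; rewrite /zC !rmorphD. Qed.
Lemma zCM : {morph zC : x y / x * y}. Proof. by move=> x y; rewrite /zC !rmorphM. Qed.
Lemma zCN : {morph zC : x / - x}. Proof. by move=> x; rewrite /zC !rmorphN. Qed.
Lemma zC0 : zC 0 = 0. Proof. by []. Qed.
Lemma zC1 : zC 1 = 1. Proof. by []. Qed.
Lemma zC_int (n : int) : zC (Z_of_int n) = n%:~R. Proof. by rewrite /zC Z_of_intK. Qed.

Definition factor (w : mono) : C :=
  u ^+ upow w * c ^+ cpow w * \prod_(F <- cens w) kap F.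
Definition sem_mono (w : mono) : V := factor w *: \sum_e word (value e) (letters w).
Definition sem (E : expr) : V := 72%:R^-1 *: \sum_(t <- E) zC t.1 *: sem_mono t.2.

Lemma sem_nil : sem [::] = 0.
Proof. by rewrite /sem big_nil scaler0. Qed.
Lemma sem_cons t E : sem (t :: E) = 72%:R^-1 *: (zC t.1 *: sem_mono t.2) + sem E.
Proof. by rewrite /sem big_cons scalerDr. Qed.
Lemma sem_cat E E' : sem (E ++ E') = sem E + sem E'.
Proof. by rewrite /sem big_cat scalerDr. Qed.
Lemma sem_scale x E : sem (scale x E) = zC x *: sem E.
Proof.
elim: E => [|t E IH]; first by rewrite sem_nil scaler0.
by rewrite [scale _ _]/= !sem_cons IH scalerDr /= zCM !scalerA; congr (_ *: _ + _); ring.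
Qed.
Lemma sem_sub E E' : sem (sub_expr E E') = sem E - sem E'.
Proof. by rewrite sem_cat sem_scale -[zC _]/(- 1 : C) scaleN1r. Qed.

(** A monomial with the Kronecker deltas [ds] not yet eliminated. *)
Definition sem_deltas (ds : seq (nat * nat)) (w : mono) : V :=
  factor w *: \sum_e (\prod_(d <- ds) (value e d.1 == value e d.2)%:R) *: word (value e) (letters w).

Lemma sem_contract s ds w : bounded (letters w) ->
    all (fun d => (s d.1 < nvar)%N && (s d.2 < nvar)%N) ds ->
  sem_mono (contract s ds w) = sem_deltas [seq (s d.1, s d.2) | d <- ds] w.
Proof.
elim: ds s w => [|d ds IH] s w w6 /=.
  rewrite /sem_deltas /sem_mono => _; congr (_ *: _); apply: eq_bigr => e _.
  by rewrite big_nil scale1r.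
case/andP=> /andP[d1 d2] ds6; have [d12|d12] := eqVneq (s d.1) (s d.2).
  rewrite IH // /sem_deltas; congr (_ *: _); apply: eq_bigr => e _.
  by rewrite big_cons /= d12 eqxx mul1r.
set r := identify _ _.
have r6 l : (l < nvar)%N -> (r l < nvar)%N by rewrite /r /identify; case: ifP.
rewrite IH /=; first last.
- by apply/allP => d' /(allP ds6)/andP[? ?]; rewrite !r6.
- by rewrite /bounded all_map; apply: sub_all w6 => x /andP[? ?] /=; rewrite !r6.
pose X (e : nat -> 'I_M) :=
  (\prod_(d <- ds) (e (s d.1) == e (s d.2))%:R) *: word e (letters w).
have Xext e e' : {in gtn nvar, e =1 e'} -> X e = X e'.
  move=> ee'; rewrite /X (eq_word w6 ee'); congr (_ *: _).
  by apply: eq_big_seq => d' /(allP ds6)/andP[? ?]; rewrite !ee'.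
transitivity (factor w *: (u *: \sum_e X (value e \o r))).
  rewrite scalerA; congr (_ *: _); first by rewrite /factor exprS; ring.
  by apply: eq_bigr => e _; rewrite big_map word_rename.
rewrite -(sum_identify Xext) //; congr (_ *: _); apply: eq_bigr => e _.
by rewrite /X scalerA big_cons big_map.
Qed.

(** * Soundness of the rewriting *)

(** What a list of terms contributes, before the overall factor 1/72. *)
Definition expand (E : expr) : V := \sum_(t <- E) zC t.1 *: sem_mono t.2.

Lemma bounded_cat ls ls' : bounded (ls ++ ls') = bounded ls && bounded ls'.
Proof. exact: all_cat. Qed.

Local Arguments contract : simpl never.

Lemma sem_swap w pre x y suf : letters w = pre ++ x :: y :: suf -> bounded (letters w) ->
  sem_mono w = expand (swap_terms w pre x y suf).
Proof.
move=> wE w6; have := w6; rewrite wE bounded_cat /=.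
case/and3P=> pre6 /andP[x1 x2] /andP[/andP[y1 y2] suf6].
have ctr ds w' : bounded (letters w') -> all (fun d => (d.1 < nvar)%N && (d.2 < nvar)%N) ds ->
    sem_mono (contract id ds w') = sem_deltas ds w'.
  by move=> w'6 ds6; rewrite sem_contract // map_id_in // => -[].
rewrite /expand /swap_terms big_cat !big_cons big_nil /= addr0.
rewrite !ctr /= ?x1 ?x2 ?y1 ?y2 ?bounded_cat //= ?pre6 /= ?x1 ?x2 ?y1 ?y2 //=.
rewrite !zC1 !scale1r -[zC _]/(-1 : C) scaleN1r [LHS]/sem_mono /sem_deltas.
rewrite wE (eq_bigr _ (fun e _ => word_swap (value e) pre x y suf)).
rewrite !sumrB big_split /= !scalerBr scalerDr -!addrA; congr (_ + (_ + (_ + _))).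
- by congr (_ *: _); apply: eq_bigr => e _; rewrite big_seq1.
- by congr (- (_ *: _)); apply: eq_bigr => e _; rewrite big_seq1.
case: ifP => n0; last by rewrite big_nil big1 ?scaler0 ?oppr0.
rewrite !big_cons big_nil addr0 /= !ctr /= ?x1 ?x2 ?y1 ?y2 ?bounded_cat ?pre6 //.
rewrite zCN zC_int /sem_deltas !scalerA !scaler_sumr -sumrN -big_split /=.
apply: eq_bigr => e _; rewrite !big_cons !big_nil !scalerA -scalerDl -scaleNr.
by congr (_ *: _); rewrite /factor /= big_cons exprS; ring.
Qed.

Lemma word_kills_vacuum e ls : kills_vacuum ls -> word e ls = 0.
Proof.
elim: ls => // x ls IH; rewrite [kills_vacuum _]/=.
case: ifP => [/orP[tot|/andP[/nilP -> x_ge0]] _|_ /IH ls0].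
- exact: word_total_gt0.
- exact: (word_nonneg_last e [::]).
- by rewrite word_cons ls0 linear0.
Qed.

Lemma sum_has_trace pre ls : bounded (pre ++ ls) -> has_trace pre ls ->
  \sum_e word (value e) (pre ++ ls) = 0.
Proof.
elim: ls pre => // x ls IH pre b /=; case: ifP => [/andP[/eqP rc others] _|_]; last first.
  by rewrite -cat_rcons => /IH -> //; rewrite cat_rcons.
have x6 : (row x < nvar)%N.
  by move: b; rewrite bounded_cat /= => /and3P[_ /andP[]].
rewrite (sum_upd _ x6) big1 ?scaler0 // => e _.
pose avoids (y : letter) := (row y != row x) && (col y != row x).
have avoid_upd a (s : seq letter) v : bounded s -> all avoids s ->
    act (value (upd e (row x) a)) s v = act (value e) s v.
  elim: s => // y s IHs /= /andP[/andP[y1 y2] s6] /andP[/andP[/negPf yr /negPf yc] sx].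
  by rewrite IHs // !value_upd // yr yc.
move: b others; rewrite bounded_cat all_cat => /and3P[pre6 _ ls6] /andP[pre_x ls_x].
transitivity (\sum_a act (value e) pre (op (mode x) (lab x) a a (act (value e) ls vac))).
  apply: eq_bigr => a _; rewrite word_cat word_cons /word !avoid_upd //.
  by rewrite -rc value_upd // eqxx.
by rewrite -linear_sum current_trace // linear0.
Qed.

Lemma find_mapP (A B : Type) (h : A -> option B) s n b (x0 : A) :
    find_map h s = Some (n, b) ->
  s = take n s ++ nth x0 s n :: drop n.+1 s /\ h (nth x0 s n) = Some b.
Proof.
elim: s n => //= x s IH n; case E : (h x) => [b'|].
  by case=> <- <-; rewrite drop0.
by case F : (find_map h s) => [[m b']|] // [<- b'b] /=; rewrite b'b in F; have [<- ->] := IH _ F.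
Qed.

Lemma label_at_partial_fractions F F1 F2 : partial_fractions F = Some (F1, F2) ->
  forall l, label_at f g F l = c * (label_at f g F1 l - label_at f g F2 l).
Proof.
case: F => [[|a] [|b]] //= [<- <-] l; rewrite /label_at /= !exprS.
by rewrite mulrACA fg; ring.
Qed.

Lemma kap_partial_fractions F F1 F2 : partial_fractions F = Some (F1, F2) ->
  kap F = c * kap F1 - c * kap F2.
Proof.
move=> hF; rewrite /level_at !mulr_sumr -sumrB; apply: eq_bigr => l _.
by rewrite (label_at_partial_fractions hF); ring.
Qed.

Lemma current_partial_fractions n F F1 F2 a b v : partial_fractions F = Some (F1, F2) ->
  op n F a b v = c *: op n F1 a b v - c *: op n F2 a b v.
Proof.
move=> hF; rewrite /current !scaler_sumr -sumrB; apply: eq_bigr => l _.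
by rewrite (label_at_partial_fractions hF) !scalerA -scalerBl mulrBr.
Qed.

Lemma sem_swap_at w n E : bounded (letters w) -> swap_at w n = Some E ->
  sem_mono w = expand E.
Proof.
move=> w6; rewrite /swap_at; case D : (drop n (letters w)) => [|x [|y suf]] // [<-].
by apply: sem_swap; rewrite // -D cat_take_drop.
Qed.

Lemma sem_step w E : step w = Some E -> sem_mono w = expand E.
Proof.
rewrite /step; case: ifP => // /negbFE w6.
case: ifP => [/orP[kv|tr] [<-]|_].
- rewrite /expand big_nil /sem_mono big1 ?scaler0 // => e _.
  exact: word_kills_vacuum.
- by rewrite /expand big_nil /sem_mono (sum_has_trace (pre := [::])) ?scaler0.
case: first_pair => [n /sem_swap_at -> //|].
case D : find_map => [[n [F1 F2]]|].
  case=> <-; have [ksE hF] := find_mapP (0, 0)%N D.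
  rewrite /expand !big_cons big_nil addr0 /= zC1 -[zC _]/(-1 : C) scale1r scaleN1r.
  rewrite /sem_mono /= -scalerBl; congr (_ *: _); rewrite /factor /= [in LHS]ksE.
  rewrite !big_cat !big_cons /= (kap_partial_fractions hF) exprS.
  by ring.
case D' : find_map => [[n [F1 F2]]|].
  case=> <-; have [lsE hF] := find_mapP letter0 D'.
  have wordE e : word e (letters w) =
      c *: word e (set_at (letters w) n (relabel (nth letter0 (letters w) n) F1)) -
      c *: word e (set_at (letters w) n (relabel (nth letter0 (letters w) n) F2)).
    rewrite {1}lsE /set_at !word_cat !word_cons /= (current_partial_fractions _ _ _ _ hF).
    by rewrite linearB !linearZ.
  rewrite /expand !big_cons big_nil addr0 /= zC1 -[zC _]/(-1 : C) scale1r scaleN1r.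
  rewrite /sem_mono (eq_bigr _ (fun e _ => wordE (value e))) sumrB -!scaler_sumr.
  rewrite scalerBr !scalerA /=.
  by congr (_ *: _ - _ *: _); rewrite /factor /= exprS; ring.
by case: choose_swap => [n /sem_swap_at -> //|].
Qed.

Lemma sem_tidy w : sem_mono (tidy w) = sem_mono w.
Proof.
rewrite /sem_mono /factor /=; congr ((_ * _) *: _).
  by apply: perm_big; rewrite perm_sort.
case: ifP => // /andP[w6]; rewrite -[[:: 0; _; _; _; _; _]%N]/(iota 0 nvar) => r_perm; set r := row_order _ in r_perm *.
pose h (e : env) : env := [ffun i : 'I_nvar => value e (index (val i) r)].
have h_inj : injective h.
  move=> e e' hE; apply/ffunP => i.
  have ir : val i \in iota 0 nvar by rewrite mem_iota /= ltn_ord.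
  have i_lt : (i < size r)%N by rewrite (perm_size r_perm) size_iota.
  have r_uniq : uniq r by rewrite (perm_uniq r_perm) iota_uniq.
  have ri6 : (nth 0 r i < nvar)%N.
    by have := mem_nth 0%N i_lt; rewrite (perm_mem r_perm) mem_iota => /andP[].
  have := congr1 (fun e : env => e (Ordinal ri6)) hE.
  by rewrite !ffunE /= index_uniq // /value inord_val.
rewrite [RHS](reindex_inj h_inj); apply: eq_bigr => e _; rewrite word_rename.
apply: eq_word => // i; rewrite inE => i6.
by rewrite /h /value ffunE /= inordK.
Qed.

Lemma eq_monoP v w : eq_mono v w -> v = w.
Proof.
case: v w => [u1 c1 k1 l1] [u2 c2 k2 l2]; rewrite /eq_mono /=.
case: eqP => // ->; case: eqP => // ->; case: ifP => // ll /eqP ->.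
congr Mono; elim: l1 l2 ll => [|x l1 IH] [|y l2] //=; case: ifP => // xy /IH ->.
congr cons; case: x y xy => [m1 F1 r1 s1] [m2 F2 r2 s2]; rewrite /eq_letter /=.
by case: eqP => // ->; case: eqP => // ->; case: eqP => // -> /eqP ->.
Qed.

Lemma expand_cons t E : expand (t :: E) = zC t.1 *: sem_mono t.2 + expand E.
Proof. by rewrite /expand big_cons. Qed.

Lemma expand_insert t E : expand (insert t E) = zC t.1 *: sem_mono t.2 + expand E.
Proof.
elim: E => [|t' E IH] /=.
  by case: eqP => [->|_]; rewrite ?expand_cons // /expand !big_nil zC0 scale0r addr0.
case: ifP => [/eq_monoP tt'|_]; last by rewrite !expand_cons IH addrCA.
rewrite !expand_cons tt' addrA -scalerDl -zCD.
by case: eqP => [->|_]; rewrite ?expand_cons // zC0 scale0r add0r.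
Qed.

Lemma expand_sweep E : expand (sweep E) = expand E.
Proof.
rewrite /sweep -[RHS]addr0 -[X in _ + X](_ : expand [::] = 0); last by rewrite /expand big_nil.
elim: E [::] => [|t E IH] acc /=; first by rewrite /expand !big_nil add0r.
rewrite IH expand_cons [LHS]addrC [RHS]addrAC; congr (_ + _).
case St : (step t.2) => [E'|]; last by rewrite expand_insert sem_tidy.
rewrite (sem_step St) /=; elim: E' acc {St} => [|s E' IH'] acc /=.
  by rewrite /expand big_nil scaler0 add0r.
by rewrite IH' expand_insert sem_tidy expand_cons zCM scalerDr scalerA addrCA addrA.
Qed.

(** Every rewriting step preserves the vector of an expression, whichever letters
    the strategy chooses to exchange. *)
Lemma vanishes_sound E : vanishes E -> sem E = 0.
Proof.
rewrite /vanishes /sem -/(expand E); set n := 40%N => /nilP En.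
have iterE : expand (iter n sweep E) = expand E.
  by elim: n {En} => //= n IH; rewrite expand_sweep.
by rewrite -iterE En /expand big_nil scaler0.
Qed.

(** * Soundness of the formal operations *)

Lemma sem_expand E : sem E = 72%:R^-1 *: expand E. Proof. by []. Qed.

Lemma sem_extend (h : mono -> expr) (L : {linear V -> V}) :
  (forall w, L (sem_mono w) = expand (h w)) -> forall E, sem (extend h E) = L (sem E).
Proof.
move=> hL; elim=> [|t E IH]; first by rewrite sem_nil linear0.
rewrite [extend _ _]/(scale t.1 (h t.2) ++ extend h E) sem_cat sem_scale IH sem_cons.
have LZ a b v : L (a *: (b *: v)) = a *: (b *: L v) by rewrite 2!linearZ.
by rewrite linearD LZ hL; congr (_ + _); rewrite sem_expand !scalerA mulrC.
Qed.

Lemma sem_kmul F E : sem (kmul F E) = (u * kap F) *: sem E.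
Proof.
elim: E => [|t E IH]; first by rewrite sem_nil scaler0.
rewrite [kmul _ _]/= !sem_cons IH scalerDr; congr (_ + _).
rewrite /sem_mono !scalerA; congr (_ *: _).
by rewrite /factor /= exprS big_cons; ring.
Qed.

Lemma sem_cmul E : sem (cmul E) = c *: sem E.
Proof.
elim: E => [|t E IH]; first by rewrite sem_nil scaler0.
rewrite [cmul _]/= !sem_cons IH scalerDr; congr (_ + _).
rewrite /sem_mono !scalerA; congr (_ *: _).
by rewrite /factor /= exprS; ring.
Qed.

Lemma sem_Dexpr i j A : sem (Dexpr i j A) =
  j%:R *: sem (dexpr false A) - i%:R *: sem (dexpr true A)
  - ((i * j)%N%:R * u * (kap (1, 0)%N - kap (0, 1)%N)) *: sem A.
Proof.
rewrite /Dexpr !sem_cat !sem_scale !sem_kmul !zCN !zC_int -!pmulrn.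
rewrite -addrA !scaleNr; congr (_ + (_ + _)).
by rewrite !scalerA -!scaleNr -scalerDl; congr (_ *: _); ring.
Qed.

Section Translation.
Variable T : {linear V -> V}.
Hypothesis TP : is_translation rho vac T.

Lemma T_current n F a b v :
  T (op n F a b v) = op n F a b (T v) - n%:~R *: op (n - 1) F a b v.
Proof.
rewrite /current linear_sum scaler_sumr -sumrB; apply: eq_bigr => l _.
have /eqP := proj2 TP l (eunit C a b) n v (eunit_sl C M_gt0 a b).
by rewrite subr_eq => /eqP TE; rewrite linearZ /= TE scalerDr scalerN !scalerA mulrC addrC.
Qed.

Lemma T_word e ls : T (word e ls) = \sum_(t <- leibniz Tletter ls) zC t.1 *: word e t.2.
Proof.
elim: ls => [|x ls IH]; first by rewrite big_nil; apply: (proj1 TP).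
rewrite word_cons T_current IH /= big_cons big_map /= word_cons zCN zC_int scaleNr addrC.
by congr (_ + _); rewrite linear_sum; apply: eq_bigr => t _; rewrite linearZ.
Qed.

Lemma sem_Texpr E : sem (Texpr E) = T (sem E).
Proof.
apply: sem_extend => w; rewrite /expand /Tmono big_map /sem_mono linearZ linear_sum /=.
under eq_bigr do rewrite T_word.
rewrite exchange_big scaler_sumr; apply: eq_bigr => t _ /=.
by rewrite !scaler_sumr; apply: eq_bigr => e _; rewrite !scalerA mulrC.
Qed.
End Translation.

Section ZeroMode.
Variables (T : {linear V -> V}) (Y : V -> int -> {linear V -> V}).
Hypothesis YP : is_vacuum_vertex_algebra rho vac T Y.

Let YP1 : is_vertex_algebra vac T Y. Proof. by case: YP. Qed.

Lemma Y_zero n v : Y 0 n v = 0.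
Proof.
have := va_linear YP1 1 0 0 n v; rewrite scaler0 addr0 scale1r => /esym/eqP.
by rewrite -subr_eq0 addrK => /eqP.
Qed.
Lemma Y_scale a X n v : Y (a *: X) n v = a *: Y X n v.
Proof. by rewrite -[_ *: _]addr0 (va_linear YP1) Y_zero addr0. Qed.
Lemma Y_sum (I : Type) (s : seq I) (X : I -> V) n v :
  Y (\sum_(i <- s) X i) n v = \sum_(i <- s) Y (X i) n v.
Proof.
elim: s => [|i s IH]; first by rewrite !big_nil Y_zero.
by rewrite !big_cons -IH -[X i]scale1r (va_linear YP1) !scale1r.
Qed.

Lemma Y_current F a b n v : Y (op (-1) F a b vac) n v = op n F a b v.
Proof.
case: YP => _ Ycur _ _; rewrite /current Y_sum; apply: eq_bigr => l _.
by rewrite Y_scale Ycur ?eunit_sl.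
Qed.

Definition creators (xs : seq letter) := all (fun x => mode x == -1) xs.

Lemma modes_cons L x y xs m ls : modes L (x :: y :: xs) m ls =
  flatten [seq [seq at_mode x (- l.+1%:Z) :: t | t <- modes L (y :: xs) (m + l%:Z) ls] ++
               modes L (y :: xs) (m - l%:Z - 1) (at_mode x l%:Z :: ls) | l <- iota 0 L].
Proof. by []. Qed.

Lemma total_modes L xs m ls :
  all (fun t => total t + (size xs)%:Z == total ls + m + 1) (modes L xs m ls).
Proof.
elim: xs m ls => // x [|y xs] IH m ls; first by rewrite /modes /= andbT; apply/eqP; lia.
rewrite modes_cons.
elim: (iota 0 L) => // l s IHs; rewrite /= !all_cat all_map IHs andbT.
apply/andP; split.
  by apply: sub_all (IH (m + l%:Z) ls) => t /= /eqP; lia.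
by apply: sub_all (IH (m - l%:Z - 1) (at_mode x l%:Z :: ls)) => t /= /eqP; lia.
Qed.

Lemma sum_modes_eq0 e L xs m ls : (size xs)%:Z <= total ls + m ->
  \sum_(t <- modes L xs m ls) word e t = 0.
Proof.
move=> tot; move: (total_modes L xs m ls); elim: (modes _ _ _ _) => [|t ts IH].
  by rewrite big_nil.
move=> /= /andP[/eqP t_tot /IH ts0]; rewrite big_cons ts0 addr0.
by apply: word_total_gt0; lia.
Qed.

(** The hypotheses on L make the total mode of all terms beyond the cut-off
    positive, so that these vanish. *)
Lemma Y_word e L x xs m ls : creators (x :: xs) ->
    0 < total ls + L%:Z -> (size xs)%:Z <= total ls + m + L%:Z ->
  Y (word e (x :: xs)) m (word e ls) = \sum_(t <- modes L (x :: xs) m ls) word e t.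
Proof.
elim: xs x m ls => [|y xs IH] x m ls.
  by move=> /= /andP[/eqP x1 _] _ _; rewrite big_seq1 !word_cons x1 Y_current.
rewrite /creators [all _ _]/= => /andP[/eqP x1 xs1] L_ls; rewrite [size _]/= => L_size.
set X := op (-1) (lab x) (e (row x)) (e (col x)) vac.
have YX n ls' : Y X n (word e ls') = word e (at_mode x n :: ls') by rewrite Y_current.
have -> : word e (x :: y :: xs) = Y X (-1) (word e (y :: xs)).
  by rewrite YX word_cons x1.
case: YP => _ _ _ /(_ X (word e (y :: xs)) m (word e ls)) [L0 nord].
rewrite (nord (maxn L0 L)) ?leq_maxl //.
rewrite -(big_mkord xpredT (fun l => Y X (- l.+1%:Z) (Y (word e (y :: xs)) (m + l%:Z) (word e ls))
   + Y (word e (y :: xs)) (m - l%:Z - 1) (Y X l%:Z (word e ls)))).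
rewrite (big_cat_nat (leq0n L) (leq_maxr L0 L)) /= [X in _ + X]big1_seq ?addr0; last first.
  move=> l /andP[_]; rewrite mem_index_iota => /andP[Ll _].
  rewrite IH //=; try lia.
  rewrite sum_modes_eq0 ?linear0 ?add0r; last by rewrite /=; lia.
  by rewrite YX (@word_total_gt0 _ (at_mode x l%:Z :: ls)) ?linear0 //=; lia.
rewrite modes_cons big_flatten big_map.
rewrite /index_iota subn0; apply: eq_bigr => l _.
rewrite IH //; try by rewrite /=; lia.
rewrite YX IH //=; try by rewrite /=; lia.
by rewrite big_cat big_map linear_sum /=; congr (_ + _); apply: eq_bigr => t _; rewrite YX.
Qed.

End ZeroMode.
End Words.

Arguments word : simpl never.

(** * Rational functions of two variables and their derivatives *)

Section RationalFunctions.
Variables (C : numFieldType) (V : lmodType C).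
Local Notation poly2 := {poly {poly C}}.

(** [false] stands for the derivative along z, [true] for that along w. *)
Definition dpoly (b : bool) : poly2 -> poly2 := if b then @deriv_w C else @deriv_z C.

Lemma ev2D (u v : poly2) z w : (u + v).[z, w] = u.[z, w] + v.[z, w].
Proof. by rewrite !hornerD. Qed.
Lemma ev2B (u v : poly2) z w : (u - v).[z, w] = u.[z, w] - v.[z, w].
Proof. by rewrite !(hornerD, hornerN). Qed.
Lemma ev2M (u v : poly2) z w : (u * v).[z, w] = u.[z, w] * v.[z, w].
Proof. by rewrite !hornerM. Qed.

Lemma dpolyD b : {morph dpoly b : u v / u + v}.
Proof.
case: b => u v; last exact: derivD.
by rewrite /dpoly /deriv_w raddfD.
Qed.

Lemma dpolyM b u v : dpoly b (u * v) = dpoly b u * v + u * dpoly b v.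
Proof.
case: b; last exact: derivM.
apply/polyP => i; rewrite /dpoly /deriv_w coef_map coefD !coefM /= linear_sum -big_split /=.
by apply: eq_bigr => j _; rewrite derivM !coef_map.
Qed.

Lemma dpolyC b (x : C) : dpoly b x%:P%:P = 0.
Proof.
case: b; rewrite /dpoly /deriv_w /deriv_z ?derivC //.
by rewrite map_polyC /= derivC.
Qed.
Lemma dpoly1 b : dpoly b 1 = 0.
Proof. by have := dpolyC b 1; rewrite !polyC1. Qed.

Definition rval (r : {ratio poly2}) z w : C := (\n_r).[z, w] / (\d_r).[z, w].
Definition rderiv b (r : {ratio poly2}) z w : C := rval (ratio_deriv (dpoly b) r) z w.
Definition rmul (r s : {ratio poly2}) := Ratio (\n_r * \n_s) (\d_r * \d_s).
Definition radd (r s : {ratio poly2}) := Ratio (\n_r * \d_s + \n_s * \d_r) (\d_r * \d_s).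

Lemma denom_neq0 (r : {ratio poly2}) : \d_r != 0.
Proof. exact: denom_ratioP. Qed.

Lemma n_Ratio (a b : poly2) : b != 0 -> \n_(Ratio a b) = a.
Proof. by move=> b0; rewrite numden_Ratio. Qed.
Lemma d_Ratio (a b : poly2) : b != 0 -> \d_(Ratio a b) = b.
Proof. by move=> b0; rewrite numden_Ratio. Qed.

Lemma n_rmul r s : \n_(rmul r s) = \n_r * \n_s.
Proof. by rewrite n_Ratio ?mulf_neq0 ?denom_neq0. Qed.
Lemma d_rmul r s : \d_(rmul r s) = \d_r * \d_s.
Proof. by rewrite d_Ratio ?mulf_neq0 ?denom_neq0. Qed.

Lemma rderivE b r z w : rderiv b r z w =
  ((dpoly b \n_r).[z, w] * (\d_r).[z, w] - (\n_r).[z, w] * (dpoly b \d_r).[z, w])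
    / (\d_r).[z, w] ^+ 2.
Proof.
rewrite /rderiv /rval /ratio_deriv n_Ratio ?d_Ratio ?expf_neq0 ?denom_neq0 //.
by rewrite ev2B [\d_r ^+ 2]expr2 !ev2M -expr2.
Qed.

Section Defined.
Variables (r s : {ratio poly2}) (z w : C).
Hypotheses (r0 : (\d_r).[z, w] != 0) (s0 : (\d_s).[z, w] != 0).

Lemma rval_mul : rval (rmul r s) z w = rval r z w * rval s z w.
Proof. by rewrite /rval n_rmul d_rmul !ev2M; field; rewrite r0 s0. Qed.

Lemma rderiv_mul b : rderiv b (rmul r s) z w =
  rderiv b r z w * rval s z w + rval r z w * rderiv b s z w.
Proof.
rewrite !rderivE /rval n_rmul d_rmul !dpolyM !ev2D !ev2M.
by field; rewrite r0 s0.
Qed.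

Lemma rval_add : rval (radd r s) z w = rval r z w + rval s z w.
Proof.
rewrite /rval n_Ratio ?d_Ratio ?mulf_neq0 ?denom_neq0 // !ev2D !ev2M.
by field; rewrite r0 s0.
Qed.

Lemma rderiv_add b : rderiv b (radd r s) z w = rderiv b r z w + rderiv b s z w.
Proof.
rewrite !rderivE n_Ratio ?d_Ratio ?mulf_neq0 ?denom_neq0 //.
rewrite !(dpolyD, dpolyM, ev2D, ev2M).
by field; rewrite r0 s0.
Qed.
End Defined.

(** [ok] is the set of points at which denominators are required not to
    vanish. *)
Variable ok : C -> C -> Prop.

(** r is given by a ratio of polynomials, and dr by its formal derivatives. *)
Definition ratrep (r : C -> C -> C) (dr : bool -> C -> C -> C) : Prop :=
  exists s : {ratio poly2}, forall z w, ok z w ->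
    [/\ (\d_s).[z, w] != 0, rval s z w = r z w & forall b, rderiv b s z w = dr b z w].

Lemma ratrep_ext r r' dr dr' :
  (forall z w, ok z w -> r z w = r' z w) ->
  (forall b z w, ok z w -> dr b z w = dr' b z w) ->
  ratrep r dr -> ratrep r' dr'.
Proof.
move=> rE drE [s sP]; exists s => z w zw; have [s0 sr sdr] := sP z w zw.
by split=> // [|b]; rewrite -?rE -?drE.
Qed.

Lemma ratrep_mul r dr s ds : ratrep r dr -> ratrep s ds ->
  ratrep (fun z w => r z w * s z w)
         (fun b z w => dr b z w * s z w + r z w * ds b z w).
Proof.
move=> [r' rP] [s' sP]; exists (rmul r' s') => z w zw.
have [r0 rv rd] := rP z w zw; have [s0 sv sd] := sP z w zw.
by rewrite d_rmul ev2M mulf_neq0 // rval_mul // rv sv; split=> // b; rewrite rderiv_mul // rd rv sd sv.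
Qed.

Lemma ratrep_add r dr s ds : ratrep r dr -> ratrep s ds ->
  ratrep (fun z w => r z w + s z w) (fun b z w => dr b z w + ds b z w).
Proof.
move=> [r' rP] [s' sP]; exists (radd r' s') => z w zw.
have [r0 rv rd] := rP z w zw; have [s0 sv sd] := sP z w zw.
rewrite d_Ratio ?mulf_neq0 ?denom_neq0 // ev2M mulf_neq0 // rval_add // rv sv.
by split=> // b; rewrite rderiv_add // rd sd.
Qed.

Lemma ratrep_const a : ratrep (fun _ _ => a) (fun _ _ _ => 0).
Proof.
exists (Ratio a%:P%:P 1) => z w _; rewrite d_Ratio ?oner_neq0 // hornerC hornerC.
split; rewrite ?oner_neq0 //.
  by rewrite /rval n_Ratio ?d_Ratio ?oner_neq0 // !hornerC divr1.
move=> b; rewrite rderivE n_Ratio ?d_Ratio ?oner_neq0 //.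
by rewrite dpolyC dpoly1 !horner0 mul0r mulr0 subrr mul0r.
Qed.

Lemma ratrep_inv (q : poly2) : q != 0 -> (forall z w, ok z w -> q.[z, w] != 0) ->
  ratrep (fun z w => q.[z, w]^-1)
         (fun b z w => - ((dpoly b q).[z, w] * q.[z, w]^-1 ^+ 2)).
Proof.
move=> q0 qok; exists (Ratio 1 q) => z w zw; rewrite d_Ratio // qok //.
split=> // [|b].
  by rewrite /rval n_Ratio ?d_Ratio // !hornerC div1r.
rewrite rderivE n_Ratio ?d_Ratio // dpoly1 !horner0 mul0r sub0r !hornerC mul1r.
by rewrite exprVn mulNr.
Qed.

Lemma ratrep_sum (I : Type) (s : seq I) r dr : (forall i, ratrep (r i) (dr i)) ->
  ratrep (fun z w => \sum_(i <- s) r i z w) (fun b z w => \sum_(i <- s) dr i b z w).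
Proof.
move=> rP; elim: s => [|i s IH].
  by apply: ratrep_ext (ratrep_const 0) => [z w _|b z w _]; rewrite big_nil.
apply: ratrep_ext (ratrep_add (rP i) IH) => [z w _|b z w _]; rewrite big_cons //.
Qed.

Lemma ratrep_exp r dr n : ratrep r dr ->
  ratrep (fun z w => r z w ^+ n) (fun b z w => n%:R * r z w ^+ n.-1 * dr b z w).
Proof.
move=> rP; elim: n => [|n IH].
  by apply: ratrep_ext (ratrep_const 1) => [z w _|b z w _]; rewrite ?expr0 ?mul0r.
apply: ratrep_ext (ratrep_mul rP IH) => [z w _|b z w _]; rewrite ?exprS //=.
by case: n {IH} => [|n] /=; rewrite ?exprS -?[n.+2%:R]natr1; ring.
Qed.

(** The analogue of [ratrep] for vector-valued functions.  Carrying the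
    derivatives along makes the closure properties below compute the formal
    derivatives of everything built from them. *)
Definition rep (F : C -> C -> V) (dF : bool -> C -> C -> V) : Prop :=
  exists A : vrat V, forall z w, ok z w ->
    [/\ vrat_defined A z w, vrat_eval A z w = F z w
      & forall b, vrat_eval (vrat_deriv (dpoly b) A) z w = dF b z w].

Lemma rep_ext F F' dF dF' :
  (forall z w, ok z w -> F z w = F' z w) ->
  (forall b z w, ok z w -> dF b z w = dF' b z w) ->
  rep F dF -> rep F' dF'.
Proof.
move=> FE dFE [s sP]; exists s => z w zw; have [s0 sF sdF] := sP z w zw.
by split=> // [|b]; rewrite -?FE -?dFE.
Qed.

Lemma rep_add F dF G dG : rep F dF -> rep G dG ->
  rep (fun z w => F z w + G z w) (fun b z w => dF b z w + dG b z w).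
Proof.
move=> [A AP] [B BP]; exists (A ++ B) => z w zw.
have [A0 AF AdF] := AP z w zw; have [B0 BG BdG] := BP z w zw.
rewrite /vrat_defined all_cat; split; first exact/andP.
  by rewrite /vrat_eval big_cat -/(vrat_eval A z w) -/(vrat_eval B z w) AF BG.
by move=> b; rewrite /vrat_deriv map_cat -AdF -BdG /vrat_eval big_cat.
Qed.

Definition vmul (r : {ratio poly2}) (h : V -> V) (A : vrat V) : vrat V :=
  [seq (rmul r t.1, h t.2) | t <- A].

Lemma vmul_defined r h (A : vrat V) z w : (\d_r).[z, w] != 0 ->
  vrat_defined A z w -> vrat_defined (vmul r h A) z w.
Proof.
move=> r0; rewrite /vrat_defined all_map; apply: sub_all => t /= t0.
by rewrite d_rmul ev2M mulf_neq0.
Qed.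

Lemma vmul_eval r (h : {linear V -> V}) (A : vrat V) z w : (\d_r).[z, w] != 0 ->
  vrat_defined A z w -> vrat_eval (vmul r h A) z w = rval r z w *: h (vrat_eval A z w).
Proof.
move=> r0; rewrite /vrat_eval; elim: A => [|t A IH] /=.
  by rewrite !big_nil linear0 scaler0.
case/andP=> t0 /IH {}IH; rewrite !big_cons IH [h (_ + _)]linearD [h (_ *: _)]linearZ /= scalerDr scalerA.
by rewrite -[X in X *: _ + _]/(rval (rmul r t.1) z w) rval_mul.
Qed.

Lemma vmul_deriv r (h : {linear V -> V}) (A : vrat V) b z w : (\d_r).[z, w] != 0 ->
  vrat_defined A z w ->
  vrat_eval (vrat_deriv (dpoly b) (vmul r h A)) z w =
  rderiv b r z w *: h (vrat_eval A z w)
  + rval r z w *: h (vrat_eval (vrat_deriv (dpoly b) A) z w).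
Proof.
move=> r0; rewrite /vrat_eval; elim: A => [|t A IH] /=.
  by rewrite !big_nil linear0 !scaler0 addr0.
case/andP=> t0 /IH {}IH; rewrite !big_cons IH ![h (_ + _)]linearD ![h (_ *: _)]linearZ /= !scalerDr !scalerA.
rewrite -[X in X *: _ + _]/(rderiv b (rmul r t.1) z w) rderiv_mul // scalerDl.
by rewrite addrACA.
Qed.

Lemma rep_mul r dr F dF (h : {linear V -> V}) : ratrep r dr -> rep F dF ->
  rep (fun z w => r z w *: h (F z w))
      (fun b z w => dr b z w *: h (F z w) + r z w *: h (dF b z w)).
Proof.
move=> [s sP] [A AP]; exists (vmul s h A) => z w zw.
have [s0 sr sdr] := sP z w zw; have [A0 AF AdF] := AP z w zw.
split; first exact: vmul_defined.
  by rewrite vmul_eval // sr AF.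
by move=> b; rewrite vmul_deriv // sdr sr AF AdF.
Qed.

Lemma rep_const v : rep (fun _ _ => v) (fun _ _ _ => 0).
Proof.
have [s sP] := ratrep_const 1; exists [:: (s, v)] => z w zw.
have [s0 s1 sd] := sP z w zw.
split; first by rewrite /vrat_defined /= s0.
  by rewrite /vrat_eval big_seq1 -[X in X *: _]/(rval s z w) s1 scale1r.
by move=> b; rewrite /vrat_eval big_seq1 -[X in X *: _]/(rderiv b s z w) sd scale0r.
Qed.

Lemma rep_sum (I : Type) (s : seq I) F dF : (forall i, rep (F i) (dF i)) ->
  rep (fun z w => \sum_(i <- s) F i z w) (fun b z w => \sum_(i <- s) dF i b z w).
Proof.
move=> FP; elim: s => [|i s IH].
  by apply: rep_ext (rep_const 0) => [z w _|b z w _]; rewrite big_nil.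
by apply: rep_ext (rep_add (FP i) IH) => [z w _|b z w _]; rewrite big_cons.
Qed.

Lemma rep_scale a F dF : rep F dF ->
  rep (fun z w => a *: F z w) (fun b z w => a *: dF b z w).
Proof.
move=> FP; apply: rep_ext (rep_mul idfun (ratrep_const a) FP) => // b z w _ /=.
by rewrite scale0r add0r.
Qed.

End RationalFunctions.

(** * Expressions as rational functions of z and w *)

Section Representation.
Variables (C : numFieldType) (M N : nat) (V : lmodType C).
Variables (rho : affineRep M N V) (p k : 'I_N -> C) (vac : V).

Definition site (z : C) (l : 'I_N) : C := (z - p l)^-1.

Variable ok : C -> C -> Prop.
Hypothesis ok_sites : forall z w, ok z w -> forall l, z != p l /\ w != p l.

Local Notation ratrep := (ratrep ok).
Local Notation rep := (rep ok).

Lemma deriv_one : (1 : {poly C})^`() = 0.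
Proof. by have := derivC (1 : C); rewrite polyC1. Qed.

Lemma dpoly_w_X a : dpoly true ('X - a%:P%:P) = 0 :> {poly {poly C}}.
Proof.
apply/polyP => i; rewrite /dpoly /deriv_w coef_map coefB coefX coefC coef0 /=.
by case: i => [|[|i]]; rewrite /= ?sub0r ?subr0 ?derivN ?derivC ?deriv_one ?oppr0.
Qed.

Lemma ratrep_site_z l : ratrep (fun z w => site z l)
  (fun b z w => if b then 0 else - site z l ^+ 2).
Proof.
pose q : {poly {poly C}} := 'X - (p l)%:P%:P.
have qE z w : q.[z, w] = z - p l by rewrite hornerXsubC -polyCB hornerC.
apply: ratrep_ext (ratrep_inv (q := q) (ok := ok) _ _) => [z w _|b z w _||z w zw].
- by rewrite qE.
- rewrite qE; case: b; first by rewrite dpoly_w_X !horner0 mul0r oppr0.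
  by rewrite /dpoly /deriv_z derivXsubC !hornerC mul1r.
- by rewrite polyXsubC_eq0.
- by rewrite qE subr_eq0; case: (ok_sites zw l).
Qed.

Lemma ratrep_site_w l : ratrep (fun z w => site w l)
  (fun b z w => if b then - site w l ^+ 2 else 0).
Proof.
pose q : {poly {poly C}} := ('X - (p l)%:P)%:P.
have qE z w : q.[z, w] = w - p l by rewrite hornerC hornerXsubC.
apply: ratrep_ext (ratrep_inv (q := q) (ok := ok) _ _) => [z w _|b z w _||z w zw].
- by rewrite qE.
- rewrite qE; case: b; last by rewrite /dpoly /deriv_z derivC !horner0 mul0r oppr0.
  by rewrite /dpoly /deriv_w map_polyC /= derivXsubC !hornerC mul1r.
- by rewrite polyC_eq0 polyXsubC_eq0.
- by rewrite qE subr_eq0; case: (ok_sites zw l).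
Qed.

Definition zw_poly : {poly {poly C}} := 'X - 'X%:P.

Lemma zw_polyE z w : zw_poly.[z, w] = z - w.
Proof. by rewrite hornerXsubC hornerD hornerN hornerC hornerX. Qed.

Lemma zw_poly_neq0 : zw_poly != 0.
Proof. by rewrite polyXsubC_eq0. Qed.

Lemma dpoly_zw b : dpoly b zw_poly = if b then -1 else 1.
Proof.
case: b; last exact: derivXsubC.
apply/polyP => i; rewrite /dpoly /deriv_w coef_map coefB coefX coefC coefN coef1 /=.
by case: i => [|[|i]]; rewrite /= ?sub0r ?subr0 ?derivN ?derivX ?derivC ?deriv_one ?oppr0.
Qed.

Lemma ratrep_cpow n : (n = 0%N \/ forall z w, ok z w -> z != w) ->
  ratrep (fun z w => (z - w)^-1 ^+ n)
    (fun b z w => (if b then n%:R else - n%:R) * (z - w)^-1 ^+ n.+1).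
Proof.
case=> [->|zw_neq].
  by apply: ratrep_ext (ratrep_const ok 1) => // b z w _; rewrite oppr0 if_same mul0r.
have qok z w : ok z w -> zw_poly.[z, w] != 0.
  by move=> zw; rewrite zw_polyE subr_eq0 zw_neq.
apply: ratrep_ext (ratrep_exp n (ratrep_inv zw_poly_neq0 qok)) => [z w _|b z w _].
  by rewrite zw_polyE.
rewrite !zw_polyE; case: n => [|n]; first by rewrite oppr0 if_same !mul0r.
rewrite dpoly_zw; case: b; rewrite ?hornerN ?hornerN !hornerC /= !exprS; ring.
Qed.

Local Arguments Z_of_int : simpl never.

Local Notation label_zw F l := (fun z w => label_at (site z) (site w) F l).

Lemma ratrep_label F l : ratrep (label_zw F l)
  (fun b z w => zC C (dlabel b F).1 * label_zw (dlabel b F).2 l z w).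
Proof.
apply: ratrep_ext (ratrep_mul (ratrep_exp F.1 (ratrep_site_z l))
                              (ratrep_exp F.2 (ratrep_site_w l))) => // b z w _.
rewrite /label_at; case: b; rewrite /= zCN zC_int -pmulrn /=.
  by case: F.2 => [|n] /=; rewrite !exprS; ring.
by case: F.1 => [|n] /=; rewrite !exprS; ring.
Qed.

Local Notation level F := (fun z w => level_at k (site z) (site w) F).

Lemma ratrep_level F : ratrep (level F)
  (fun b z w => zC C (dlabel b F).1 * level (dlabel b F).2 z w).
Proof.
apply: ratrep_ext (ratrep_sum (index_enum 'I_N)
   (fun l => ratrep_mul (ratrep_label F l) (ratrep_const ok (k l)))) => // b z w _.
by rewrite mulr_sumr; apply: eq_bigr => l _; rewrite mulr0 addr0 mulrA.
Qed.

Lemma ratrep_levels ks : ratrep (fun z w => \prod_(F <- ks) level F z w)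
  (fun b z w => \sum_(t <- leibniz (dlabel b) ks) zC C t.1 * \prod_(F <- t.2) level F z w).
Proof.
elim: ks => [|F ks IH].
  by apply: ratrep_ext (ratrep_const ok 1) => [z w _|b z w _]; rewrite big_nil.
apply: ratrep_ext (ratrep_mul (ratrep_level F) IH) => [z w _|b z w _].
  by rewrite big_cons.
rewrite /= big_cons big_map /= big_cons -mulrA; congr (_ + _).
by rewrite mulr_sumr; apply: eq_bigr => t _; rewrite big_cons mulrCA.
Qed.

Local Notation word_at e ls := (fun z w => word rho vac (site z) (site w) e ls).

Lemma rep_current n F a b G dG : rep G dG ->
  rep (fun z w => current rho (site z) (site w) n F a b (G z w))
      (fun d z w => zC C (dlabel d F).1 *: current rho (site z) (site w) n (dlabel d F).2 a b (G z w)
                    + current rho (site z) (site w) n F a b (dG d z w)).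
Proof.
move=> GP; apply: rep_ext (rep_sum (index_enum 'I_N)
  (fun l => rep_mul (cur rho l (eunit C a b) n) (ratrep_label F l) GP)) => // d z w _.
by rewrite big_split /= scaler_sumr; congr (_ + _); apply: eq_bigr => l _; rewrite scalerA.
Qed.

Lemma rep_word e ls : rep (word_at e ls)
  (fun b z w => \sum_(t <- leibniz (dletter b) ls) zC C t.1 *: word_at e t.2 z w).
Proof.
elim: ls => [|x ls IH].
  by apply: rep_ext (rep_const ok vac) => // b z w _; rewrite big_nil.
apply: rep_ext (rep_current (mode x) (lab x) (e (row x)) (e (col x)) IH) => // b z w _.
rewrite /= big_cons big_map /=; congr (_ + _).
by rewrite linear_sum; apply: eq_bigr => t _; rewrite linearZ.
Qed.

Local Notation sem_mono_at w := (fun z z' => sem_mono rho k vac (site z) (site z') (z - z')^-1 w).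
Local Notation sem_at E := (fun z z' => sem rho k vac (site z) (site z') (z - z')^-1 E).
Local Notation expand_at E := (fun z z' => expand rho k vac (site z) (site z') (z - z')^-1 E).

Lemma rep_sem_mono v : (cpow v = 0%N \/ forall z w, ok z w -> z != w) ->
  rep (sem_mono_at v) (fun b => expand_at (dmono b v)).
Proof.
move=> vc.
have ratf := ratrep_mul (ratrep_mul (ratrep_const ok (M%:R^-1 ^+ upow v)) (ratrep_cpow vc))
  (ratrep_levels (cens v)).
have repW := rep_sum (index_enum {ffun 'I_nvar -> 'I_M}) (fun e => rep_word (value e) (letters v)).
apply: rep_ext (rep_mul idfun ratf repW) => // b z w _.
rewrite /expand /dmono big_cons big_cat !big_map /= mul0r add0r scalerDl addrA.
congr (_ + _ + _).
- rewrite /sem_mono /factor /= !scalerA; congr (_ *: _).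
  by case: b; rewrite ?zCN zC_int -pmulrn; ring.
- rewrite mulr_sumr scaler_suml; apply: eq_bigr => t _.
  by rewrite /sem_mono /factor /= !scalerA; congr (_ *: _); ring.
- rewrite exchange_big scaler_sumr; apply: eq_bigr => t _.
  by rewrite /sem_mono /factor /= -scaler_sumr !scalerA mulrC.
Qed.

(** An expression in which c occurs is only defined off the diagonal. *)
Lemma rep_sem E :
    (all (fun t => cpow t.2 == 0%N) E \/ forall z w, ok z w -> z != w) ->
  rep (sem_at E) (fun b => sem_at (dexpr b E)).
Proof.
elim: E => [|t E IH] Ec.
  by apply: rep_ext (rep_const ok 0) => [z w _|b z w _]; rewrite sem_nil.
have tc : cpow t.2 = 0%N \/ forall z w, ok z w -> z != w.
  by case: Ec => [/= /andP[/eqP ? _]|?]; [left | right].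
have {}Ec : all (fun t => cpow t.2 == 0%N) E \/ forall z w, ok z w -> z != w.
  by case: Ec => [/= /andP[_ ?]|?]; [left | right].
apply: rep_ext (rep_add (rep_scale 72%:R^-1 (rep_scale (zC C t.1) (rep_sem_mono tc))) (IH Ec)).
  by move=> z w _; rewrite sem_cons.
move=> b z w _; have -> : dexpr b (t :: E) = scale t.1 (dmono b t.2) ++ dexpr b E by [].
by rewrite sem_cat sem_scale sem_expand !scalerA mulrC.
Qed.

End Representation.

(** * Laurent expansion at a simple pole *)

Section Laurent.
Variables (C : numFieldType) (V : lmodType C).
Local Notation poly2 := {poly {poly C}}.

Section Series.
Variables num den : {poly C}.
Hypotheses (den0 : den`_0 = 0) (den1 : den`_1 != 0).

(** The first n coefficients, last one first, of num / (den / x). *)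
Fixpoint series_rev (n : nat) : seq C :=
  if n is n'.+1 then
    let r := series_rev n' in
    (num`_n' - \sum_(l < n') den`_l.+2 * r`_l) / den`_1 :: r
  else [::].
Definition series (n : nat) : C := (series_rev n.+1)`_0.

Lemma series_revE n l : (l < n)%N -> (series_rev n)`_l = series (n.-1 - l).
Proof.
elim: n l => // n IH [_|l]; first by rewrite subn0.
rewrite ltnS => ln; rewrite [LHS]/= IH //; congr series; lia.
Qed.

Lemma series_conv n : \sum_(l < n.+1) den`_l.+1 * series (n - l) = num`_n.
Proof.
rewrite big_ord_recl subn0 {1}/series /= mulrC divfK //.
rewrite -[RHS]addr0 -addrA; congr (_ + _); rewrite addrC; apply/eqP; rewrite subr_eq0; apply/eqP.
by apply: eq_bigr => l _; rewrite series_revE // /bump /=; congr (_ * series _); lia.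
Qed.

Definition laurent_coef (n : int) : C := if n + 1 is Posz m then series m else 0.

Lemma laurent_coef_conv (n : int) :
  \sum_(l < size den) den`_l * laurent_coef (n - l%:Z) = if n is Posz m then num`_m else 0.
Proof.
pose F l := den`_l * laurent_coef (n - l%:Z).
have ext K : (size den <= K)%N -> \sum_(l < size den) F l = \sum_(l < K) F l.
  move=> dK; rewrite (big_ord_widen _ F dK) big_mkcond; apply: eq_bigr => l _.
  by case: ltnP => // dl; rewrite /F nth_default // mul0r.
case: n @F ext => m F ext.
  rewrite (ext (maxn (size den) m.+2)) ?leq_maxl //.
  transitivity (\sum_(l < m.+2) F l).
    rewrite [RHS](big_ord_widen _ F (leq_maxr (size den) _)) [RHS]big_mkcond.
    apply: eq_bigr => l _; case: ltnP => // ml; rewrite /F /laurent_coef.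
    by case E : (_ + 1) => [q|q]; rewrite ?mulr0 //; move: E; lia.
  rewrite big_ord_recl /F den0 mul0r add0r -series_conv; apply: eq_bigr => l _.
  rewrite /bump /= /laurent_coef.
  have -> : m%:Z - (1 + l)%N%:Z + 1 = (m - l)%N%:Z by have := ltn_ord l; lia.
  by [].
apply: big1 => -[[|l] /= lt_l] _; first by rewrite /F den0 mul0r.
by rewrite /laurent_coef; case E : (_ + 1) => [q|q]; rewrite ?mulr0 //; move: E; lia.
Qed.

End Series.

Definition inv_zw : {ratio poly2} := Ratio 1 (zw_poly C).

(** In terms of x = w - z0, the denominator of t / (z - w) is - x times that of t,
    which does not vanish at x = 0: there is at most a simple pole, with
    coefficient - t(z0, z0). *)
Lemma regular_simple_pole (T : {linear V -> V}) (G : vrat V) (S : seq C) :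
    (forall z, z \notin S -> vrat_defined G z z /\ exists Z, vrat_eval G z z = T Z) ->
  regular_diag_mod T (vmul inv_zw idfun G).
Proof.
move=> GP; exists S => z /GP[Gz [Z GZ]].
pose along (q : poly2) : {poly C} := q.[z%:P] \Po ('X + z%:P).
pose c (r : {ratio poly2}) := laurent_coef (along \n_r) (along \d_r).
have alongM q q' : along (q * q') = along q * along q'.
  by rewrite /along hornerM comp_polyM.
have along0 q : (along q)`_0 = q.[z, z].
  by rewrite -horner_coef0 horner_comp !hornerE.
have along_zw : along (zw_poly C) = - 'X.
  rewrite /along hornerXsubC comp_polyB comp_polyC comp_polyX opprD addrCA.
  by rewrite addrN addr0.
have nE (r : {ratio poly2}) : \n_(rmul inv_zw r) = \n_r.
  by rewrite n_rmul n_Ratio ?zw_poly_neq0 // mul1r.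
have dE (r : {ratio poly2}) : along \d_(rmul inv_zw r) = - (along \d_r * 'X).
  by rewrite d_rmul d_Ratio ?zw_poly_neq0 // alongM along_zw mulNr mulrC.
have d0 r : (along \d_(rmul inv_zw r))`_0 = 0 by rewrite dE coefN coefMX oppr0.
have d1 r : (along \d_(rmul inv_zw r))`_1 = - (\d_r).[z, z].
  by rewrite dE coefN coefMX /= along0.
exists c; split.
  move=> t /mapP[s sG ->] /=; have s0 := allP Gz s sG.
  have d1_neq0 : (along \d_(rmul inv_zw s.1))`_1 != 0 by rewrite d1 oppr_eq0.
  split.
  - by apply: contraNneq d1_neq0; rewrite -/(along _) => ->; rewrite coef0.
  - exists (-1) => n n_lt; rewrite /c /laurent_coef.
    by case E : (n + 1) => [m|m] //; move: E n_lt; lia.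
  - by move=> n; exact: (laurent_coef_conv _ (d0 s.1) d1_neq0 n).
move=> n n_lt0; have [n1|n1] := eqVneq n (-1).
  exists (- Z); rewrite linearN -GZ /vrat_eval big_map -sumrN {n_lt0}n1.
  apply: eq_big_seq => t tG /=; rewrite -scaleNr; congr (_ *: _).
  rewrite /c /laurent_coef addNr /series /= nE along0 d1 big_ord0 subr0.
  by rewrite invrN mulrN.
exists 0; rewrite linear0 big_map big1 // => t _ /=; rewrite /c /laurent_coef.
by case E : (n + 1) => [m|m]; rewrite ?scale0r //; move: E n_lt0 n1; lia.
Qed.

End Laurent.

(** * From the orthonormal basis to matrix units *)

Section Casimir.
Variables (C : numFieldType) (M : nat) (V : lmodType C).
Hypothesis M_gt0 : (0 < M)%N.
Variable I : (\dim (sl C M)).-tuple 'M[C]_M.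
Hypothesis IP : orthonormal_basis I.

Definition linear_on_sl (h : 'M[C]_M -> V) : Prop :=
  forall x a b, a \in sl C M -> b \in sl C M -> h (x *: a + b) = x *: h a + h b.

Lemma basis_sl a : tnth I a \in sl C M.
Proof. by apply: (basis_mem (proj1 IP)); apply: mem_tnth. Qed.

Lemma linear_on_sl_sum h (J : Type) (s : seq J) (x : J -> C) (a : J -> 'M[C]_M) :
    linear_on_sl h -> (forall j, a j \in sl C M) ->
  h (\sum_(j <- s) x j *: a j) = \sum_(j <- s) x j *: h (a j).
Proof.
move=> hP aP; have h0 : h 0 = 0.
  by have := hP (-1) 0 0 (mem0v _) (mem0v _); rewrite scaler0 addr0 scaleN1r addNr.
elim: s => [|j s IH]; first by rewrite !big_nil.
by rewrite !big_cons hP // ?IH //; apply: memv_suml => i _; apply: memvZ.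
Qed.

(** The coordinates in an orthonormal basis are the traces tr(I_i J_ab), that is,
    the matrix entries of the I_i. *)
Lemma eunit_basis a b : eunit C a b = \sum_i (tnth I i) b a *: tnth I i.
Proof.
have tr_eunit i : \tr (tnth I i *m eunit C a b) = (tnth I i) b a.
  rewrite /eunit mulmxBr mul_mx_scalar linearB linearZ /=.
  have := basis_sl i; rewrite mem_sl => /eqP ->; rewrite mulr0 subr0.
  rewrite /mxtrace (bigD1 b) //= mxE (bigD1 a) //= mxE !eqxx mulr1 !big1 ?addr0 // => j.
    by move=> /negPf jb; rewrite mxE big1 // => l _; rewrite mxE jb andbF mulr0.
  by move=> /negPf ja; rewrite mxE ja mulr0.
rewrite {1}(coord_basis (proj1 IP) (eunit_sl C M_gt0 a b)); apply: eq_bigr => i _.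
rewrite -(tnth_nth 0); congr (_ *: _); rewrite -tr_eunit.
rewrite [in RHS](coord_basis (proj1 IP) (eunit_sl C M_gt0 a b)) mulmx_sumr linear_sum.
rewrite (bigD1 i) //= -scalemxAr linearZ -tnth_nth /= (proj2 IP) eqxx mulr1 big1 ?addr0 //.
move=> j ji; rewrite -scalemxAr linearZ -tnth_nth /= (proj2 IP) eq_sym.
by rewrite (negPf ji) mulr0.
Qed.

Lemma eunit_linear h a b : linear_on_sl h ->
  h (eunit C a b) = \sum_i (tnth I i) b a *: h (tnth I i).
Proof. by move=> hP; rewrite eunit_basis linear_on_sl_sum //; apply: basis_sl. Qed.

(** The Casimir tensor, in the basis I and in matrix units. *)
Lemma sum_basis2 (h : 'M[C]_M -> 'M[C]_M -> V) :
    (forall y, linear_on_sl (h^~ y)) -> (forall x, linear_on_sl (h x)) ->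
  \sum_i h (tnth I i) (tnth I i) = \sum_a \sum_b h (eunit C a b) (eunit C b a).
Proof.
move=> h1 h2.
transitivity (\sum_i \sum_j \tr (tnth I i *m tnth I j) *: h (tnth I i) (tnth I j)).
  apply: eq_bigr => i _; rewrite (bigD1 i) //= (proj2 IP) eqxx scale1r big1 ?addr0 //.
  by move=> j ji; rewrite (proj2 IP) eq_sym (negPf ji) scale0r.
under [RHS]eq_bigr => a _.
  under eq_bigr => b _ do rewrite (eunit_linear _ _ (h1 _)).
  over.
symmetry; under eq_bigr do rewrite exchange_big.
rewrite exchange_big; apply: eq_bigr => i _ /=.
under eq_bigr => a _ do under eq_bigr => b _ do rewrite (eunit_linear _ _ (h2 _)) scaler_sumr.
under eq_bigr do rewrite exchange_big.
rewrite exchange_big; apply: eq_bigr => j _ /=.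
under eq_bigr do under eq_bigr do rewrite scalerA.
under eq_bigr do rewrite -scaler_suml.
rewrite -scaler_suml; congr (_ *: _); rewrite /mxtrace exchange_big.
by apply: eq_bigr => b _; rewrite mxE.
Qed.

End Casimir.

Section CasimirCubic.
Variables (C : numFieldType) (M : nat) (V : lmodType C).
Hypothesis M_gt0 : (0 < M)%N.
Variable I : (\dim (sl C M)).-tuple 'M[C]_M.
Hypothesis IP : orthonormal_basis I.
Local Notation linear_on_sl := (@linear_on_sl C M V).

Lemma exchange3 (J K : finType) (F : J -> J -> J -> K -> V) :
  \sum_a \sum_b \sum_c \sum_i F a b c i = \sum_i \sum_a \sum_b \sum_c F a b c i.
Proof.
under eq_bigr do under eq_bigr do rewrite exchange_big.
under eq_bigr do rewrite exchange_big.
by rewrite exchange_big.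
Qed.

Lemma trace_mul3 (A B D : 'M[C]_M) :
  \tr (A *m B *m D) = \sum_a \sum_b \sum_c A c b * B b a * D a c.
Proof.
transitivity (\sum_c \sum_a \sum_b A c b * B b a * D a c).
  by apply: eq_bigr => c _; rewrite mxE; apply: eq_bigr => a _; rewrite mxE mulr_suml.
by rewrite exchange_big; apply: eq_bigr => a _; rewrite exchange_big.
Qed.

(** The two terms of t_abc give the two cyclic orders of contraction. *)
Lemma sum_basis3 (h : 'M[C]_M -> 'M[C]_M -> 'M[C]_M -> V) :
    (forall y z, linear_on_sl (fun x => h x y z)) ->
    (forall x z, linear_on_sl (fun y => h x y z)) ->
    (forall x y, linear_on_sl (h x y)) ->
  \sum_i \sum_j \sum_l tabc I i j l *: h (tnth I i) (tnth I j) (tnth I l) =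
  \sum_a \sum_b \sum_c (h (eunit C a b) (eunit C b c) (eunit C c a)
                        + h (eunit C a c) (eunit C b a) (eunit C c b)).
Proof.
move=> h1 h2 h3; pose t i a b := (tnth I i) b a.
have expand3 (q : 'I_M -> 'I_M -> 'I_M -> ('I_M * 'I_M) * ('I_M * 'I_M) * ('I_M * 'I_M)) :
    \sum_a \sum_b \sum_c h (eunit C (q a b c).1.1.1 (q a b c).1.1.2)
       (eunit C (q a b c).1.2.1 (q a b c).1.2.2) (eunit C (q a b c).2.1 (q a b c).2.2) =
    \sum_i \sum_j \sum_l (\sum_a \sum_b \sum_c t i (q a b c).1.1.1 (q a b c).1.1.2
         * t j (q a b c).1.2.1 (q a b c).1.2.2 * t l (q a b c).2.1 (q a b c).2.2)
      *: h (tnth I i) (tnth I j) (tnth I l).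
  under eq_bigr do under eq_bigr do under eq_bigr do
    rewrite (eunit_linear M_gt0 IP _ _ (h1 _ _)).
  rewrite exchange3; apply: eq_bigr => i _.
  under eq_bigr do under eq_bigr do under eq_bigr do
    rewrite (eunit_linear M_gt0 IP _ _ (h2 _ _)) scaler_sumr.
  rewrite exchange3; apply: eq_bigr => j _.
  under eq_bigr do under eq_bigr do under eq_bigr do
    rewrite (eunit_linear M_gt0 IP _ _ (h3 _ _)) scaler_sumr scaler_sumr.
  rewrite exchange3; apply: eq_bigr => l _.
  rewrite scaler_suml; apply: eq_bigr => a _.
  rewrite scaler_suml; apply: eq_bigr => b _.
  by rewrite scaler_suml; apply: eq_bigr => c _; rewrite !scalerA.
under [RHS]eq_bigr do under eq_bigr do rewrite big_split.
under [RHS]eq_bigr do rewrite big_split.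
rewrite big_split /= (expand3 (fun a b c => ((a, b), (b, c), (c, a)))).
rewrite (expand3 (fun a b c => ((a, c), (b, a), (c, b)))) /= -big_split.
apply: eq_bigr => i _; rewrite -big_split; apply: eq_bigr => j _.
rewrite -big_split; apply: eq_bigr => l _; rewrite /= -scalerDl; congr (_ *: _).
rewrite /tabc linearD addrC /= !trace_mul3; congr (_ + _).
  apply: eq_bigr => a _; apply: eq_bigr => b _; apply: eq_bigr => c _.
  by rewrite /t [X in _ = X * _]mulrC.
rewrite exchange_big; apply: eq_bigr => a _; apply: eq_bigr => b _.
by apply: eq_bigr => c _; rewrite /t.
Qed.
End CasimirCubic.

(** * The states and their zero modes as expressions *)

Section States.
Variables (C : numFieldType) (M N : nat) (V : lmodType C).
Variables (rho : affineRep M N V) (p : 'I_N -> C) (vac : V).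
Hypothesis M_gt0 : (0 < M)%N.
Variable I : (\dim (sl C M)).-tuple 'M[C]_M.
Hypothesis IP : orthonormal_basis I.

Local Notation u := (M%:R^-1 : C).
Local Notation env := {ffun 'I_nvar -> 'I_M}.

Lemma sum_env_const (v : V) : \sum_(e : env) v = M%:R ^+ 6 *: v.
Proof. by rewrite sumr_const card_ffun !card_ord -natrX scaler_nat. Qed.

Lemma sum_upd_var (Z : 'I_M -> env -> V) i : (i < nvar)%N ->
    (forall a e b, Z a (upd e i b) = Z a e) ->
  \sum_e Z (value e i) e = u *: \sum_a \sum_e Z a e.
Proof.
move=> i6 Zupd; rewrite (sum_upd M_gt0 _ i6) exchange_big; congr (_ *: _).
apply: eq_bigr => a _; apply: eq_bigr => e _.
by rewrite value_upd // eqxx Zupd.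
Qed.

Lemma sum_env2 (X : 'I_M -> 'I_M -> V) i j : (i < nvar)%N -> (j < nvar)%N -> j != i ->
  u ^+ 4 *: \sum_e X (value e i) (value e j) = \sum_a \sum_b X a b.
Proof.
move=> i6 j6 ji.
rewrite (@sum_upd_var (fun a e => X a (value e j))) // => [|a e b]; last first.
  by rewrite value_upd // (negPf ji).
rewrite !scaler_sumr; apply: eq_bigr => a _.
rewrite (@sum_upd_var (fun b _ => X a b)) //.
rewrite !scaler_sumr; apply: eq_bigr => b _.
rewrite sum_env_const !scalerA -[RHS]scale1r; congr (_ *: _).
by field; apply: M_neq0.
Qed.

Lemma sum_env3 (X : 'I_M -> 'I_M -> 'I_M -> V) i j l :
    (i < nvar)%N -> (j < nvar)%N -> (l < nvar)%N -> j != i -> l != i -> l != j ->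
  u ^+ 3 *: \sum_e X (value e i) (value e j) (value e l) = \sum_a \sum_b \sum_c X a b c.
Proof.
move=> i6 j6 l6 ji li lj.
rewrite (@sum_upd_var (fun a e => X a (value e j) (value e l))) // => [|a e b]; last first.
  by rewrite !value_upd // (negPf ji) (negPf li).
rewrite !scaler_sumr; apply: eq_bigr => a _.
rewrite (@sum_upd_var (fun b e => X a b (value e l))) // => [|b e b']; last first.
  by rewrite value_upd // (negPf lj).
rewrite !scaler_sumr; apply: eq_bigr => b _.
rewrite (@sum_upd_var (fun c _ => X a b c)) //.
rewrite !scaler_sumr; apply: eq_bigr => c _.
rewrite sum_env_const !scalerA -[RHS]scale1r; congr (_ *: _).
by field; apply: M_neq0.
Qed.

Definition merge (e e' : env) : env :=
  [ffun i : 'I_nvar => if (i < 3)%N then e i else e' i].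

Lemma value_merge e e' i : (i < nvar)%N ->
  value (merge e e') i = if (i < 3)%N then value e i else value e' i.
Proof. by move=> i6; rewrite /value ffunE inordK. Qed.

(** Two independent sums over all variables, one of which only uses the first
    three and the other the last three. *)
Lemma sum_merge (H : env -> env -> V) :
    (forall e e', H e e' = H (merge e e') (merge e e')) ->
  \sum_e \sum_e' H e e' = M%:R ^+ 6 *: \sum_e H e e.
Proof.
move=> Hm; rewrite pair_big /=.
pose h (t : env * env) := (merge t.1 t.2, merge t.2 t.1).
have hK : involutive h.
  by case=> e e'; congr pair; apply/ffunP => i; rewrite !ffunE /=; case: ltnP.
under eq_bigr do rewrite Hm.
rewrite (reindex_inj (inv_inj hK)).
under eq_bigr => t _ do rewrite -[merge _ _]/((h (h t)).1) hK.
rewrite -(pair_big xpredT xpredT (fun e e' => H e e)) /=.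
by rewrite scaler_sumr; apply: eq_bigr => e _; rewrite sum_env_const.
Qed.

Section AtSite.
Variables (f g : 'I_N -> C) (F : label) (z : C).
Hypothesis Fz : forall l, label_at f g F l = site p z l.

Lemma current_cur_at n a b v : current rho f g n F a b v = cur_at rho p (eunit C a b) n z v.
Proof. by apply: eq_bigr => l _; rewrite Fz. Qed.

Lemma cur_at_linear_on_sl n v : linear_on_sl (fun a => cur_at rho p a n z v).
Proof.
move=> x a b ha hb; rewrite /cur_at scaler_sumr -big_split; apply: eq_bigr => l _.
by rewrite cur_linear //= scalerDr !scalerA mulrC.
Qed.

Lemma cur_at_linear a n : linear (cur_at rho p a n z).
Proof.
move=> x v w; rewrite /cur_at scaler_sumr -big_split; apply: eq_bigr => l _.
by rewrite linearP scalerDr !scalerA mulrC.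
Qed.

Lemma linear_on_sl_cur_at a n (h : 'M[C]_M -> V) :
  linear_on_sl h -> linear_on_sl (fun x => cur_at rho p a n z (h x)).
Proof. by move=> hP x y y' hy hy'; rewrite hP // cur_at_linear. Qed.

(** The indices may be named d, d + 1, d + 2; the sum over the unused variables is
    compensated by the power of 1/M. *)
Lemma varsigma_sum i d : (1 <= i <= 2)%N -> (d <= 3)%N ->
  varsigma rho vac p I i z = (72%:R^-1 * zC C (state_coef i) * u ^+ (5 - i)) *:
    \sum_e \sum_(s <- state_cycles i)
       word rho vac f g (value e) (map (state_letter F) (shift_cycle d s)).
Proof.
have e72 (a b : nat) : (a * b = 72)%N -> 72%:R^-1 * a%:R = b%:R^-1 :> C.
  move=> ab; have b0 : b%:R != 0 :> C by rewrite pnatr_eq0; case: b ab => //; rewrite muln0.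
  have a0 : a%:R != 0 :> C by rewrite pnatr_eq0; case: a ab.
  by rewrite -ab natrM; field; rewrite a0 b0.
case: i => [|[|[|i]]] // _ d3; rewrite /varsigma /=; last first.
  rewrite -[zC _ _]/(24%:R : C) (e72 _ 3%N) // -scalerA /varsigma2; congr (_ *: _).
  rewrite (sum_basis3 M_gt0 IP (h := fun x y x' => cur_at rho p x (-1) z
    (cur_at rho p y (-1) z (cur_at rho p x' (-1) z vac)))); first last.
  - by move=> x y; do 2!apply: linear_on_sl_cur_at; apply: cur_at_linear_on_sl.
  - by move=> x x'; apply: linear_on_sl_cur_at; apply: cur_at_linear_on_sl.
  - by move=> y x'; apply: cur_at_linear_on_sl.
  rewrite -(@sum_env3 _ d d.+1 d.+2) ?(leq_ltn_trans d3) //; try lia.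
  congr (_ *: _); apply: eq_bigr => e _; rewrite big_cons big_seq1.
  by rewrite !word_cons /= !current_cur_at ?addn0 ?addn1 ?addn2.
rewrite -[zC _ _]/(36%:R : C) (e72 _ 2%N) // -scalerA /varsigma1; congr (_ *: _).
rewrite (sum_basis2 M_gt0 IP (h := fun x y => cur_at rho p x (-1) z
    (cur_at rho p y (-1) z vac))); first last.
- by move=> x; apply: linear_on_sl_cur_at; apply: cur_at_linear_on_sl.
- by move=> y; apply: cur_at_linear_on_sl.
rewrite -(@sum_env2 _ d d.+1) ?(leq_ltn_trans d3) //; try lia.
congr (_ *: _); apply: eq_bigr => e _; rewrite big_seq1.
by rewrite !word_cons /= !current_cur_at ?addn0 ?addn1.
Qed.
End AtSite.
End States.

Section ZeroModes.
Variables (C : numFieldType) (M N : nat) (V : lmodType C).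
Variables (rho : affineRep M N V) (p k : 'I_N -> C) (vac : V).
Hypothesis M_gt0 : (0 < M)%N.
Hypothesis vacP : vacuum_like rho k vac.
Variable I : (\dim (sl C M)).-tuple 'M[C]_M.
Hypothesis IP : orthonormal_basis I.

Lemma word_ext f g (e e' : nat -> 'I_M) ls :
    all (fun x => (e (row x) == e' (row x)) && (e (col x) == e' (col x))) ls ->
  word rho vac f g e ls = word rho vac f g e' ls.
Proof.
elim: ls => // x ls IH; rewrite [all _ _]/= => /andP[/andP[/eqP r /eqP c] /IH lsE].
by rewrite !word_cons lsE r c.
Qed.

Variables (T : {linear V -> V}) (Y : V -> int -> {linear V -> V}).
Hypothesis YP : is_vacuum_vertex_algebra rho vac T Y.

Lemma sem_zero_mode i j z w c : (1 <= i <= 2)%N -> (1 <= j <= 2)%N ->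
  Y (varsigma rho vac p I i z) 0 (varsigma rho vac p I j w) =
  sem rho k vac (site p z) (site p w) c (zero_mode i j).
Proof.
move=> i12 j12; set f := site p z; set g := site p w.
have fF l : label_at f g (1, 0)%N l = site p z l by rewrite /label_at expr1 mulr1.
have gF l : label_at f g (0, 1)%N l = site p w l by rewrite /label_at expr1 mul1r.
rewrite (varsigma_sum rho vac M_gt0 IP fF (d := 0)) //.
rewrite (varsigma_sum rho vac M_gt0 IP gF (d := 3)) //.
rewrite (Y_scale YP) linearZ /= scalerA (Y_sum YP).
have coefE : 72%:R^-1 * zC C (state_coef i) * M%:R^-1 ^+ (5 - i) *
    (72%:R^-1 * zC C (state_coef j) * M%:R^-1 ^+ (5 - j)) * M%:R ^+ 6 =
    72%:R^-1 * (zC C (Z.div (state_coef i * state_coef j) 72) * M%:R^-1 ^+ (4 - (i + j))).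
  have M0 := M_neq0 C M_gt0.
  have zC18 : zC C 18 = 18%:R by []. have zC12 : zC C 12 = 12%:R by [].
  have zC8 : zC C 8 = 8%:R by []. have zC36 : zC C 36 = 36%:R by [].
  have zC24 : zC C 24 = 24%:R by [].
  case: i i12 => [|[|[|i]]] // _; case: j j12 => [|[|[|j]]] // _;
    rewrite ?zC36 ?zC24 [Z.div _ _]/= ?zC18 ?zC12 ?zC8 /=; field; exact: M0.
pose X s := map (state_letter (1, 0)%N) (shift_cycle 0 s).
pose X' s := map (state_letter (0, 1)%N) (shift_cycle 3 s).
pose H (e e' : {ffun 'I_nvar -> 'I_M}) := \sum_(s <- state_cycles i) \sum_(t <- state_cycles j)
  Y (word rho vac f g (value e) (X s)) 0 (word rho vac f g (value e') (X' t)).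
have st12 n s : (1 <= n <= 2)%N -> s \in state_cycles n ->
    [\/ s = cyc2, s = cyc3 | s = cyc3'].
  case: n => [|[|[|n]]] // _; rewrite !inE; first by move/eqP; constructor 1.
  by case/orP => /eqP; [constructor 2 | constructor 3].
transitivity ((72%:R^-1 * zC C (state_coef i) * M%:R^-1 ^+ (5 - i) *
   (72%:R^-1 * zC C (state_coef j) * M%:R^-1 ^+ (5 - j))) *: \sum_e \sum_e' H e e').
  congr (_ *: _); apply: eq_bigr => e _; rewrite linear_sum.
  apply: eq_bigr => e' _; rewrite (Y_sum YP) /H; apply: eq_bigr => s _.
  by rewrite linear_sum.
rewrite sum_merge => [|e e']; last first.
  apply: eq_big_seq => s /(st12 _ _ i12) sP; apply: eq_big_seq => t /(st12 _ _ j12) tP.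
  congr (Y _ 0 _); apply: word_ext.
    by case: sP => ->; rewrite /= !value_merge // !eqxx.
  by case: tP => ->; rewrite /= !value_merge // !eqxx.
pose W e := \sum_(s <- state_cycles i) \sum_(t <- state_cycles j)
  \sum_(ls <- modes 5 (X s) 0 (X' t)) word rho vac f g (value e) ls.
transitivity ((72%:R^-1 * (zC C (Z.div (state_coef i * state_coef j) 72)
    * M%:R^-1 ^+ (4 - (i + j)))) *: \sum_e W e).
  rewrite scalerA; congr (_ *: _); last first.
    apply: eq_bigr => e _.
    apply: eq_big_seq => s /(st12 _ _ i12) sP; apply: eq_big_seq => t /(st12 _ _ j12) tP.
    by case: sP => ->; case: tP => ->; rewrite /X /X' /=; apply: (Y_word M_gt0 vacP f g YP).
  exact: coefE.
rewrite /sem -scalerA; congr (_ *: _).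
rewrite /zero_mode /W big_flatten big_map [X in _ *: X]exchange_big scaler_sumr /=.
apply: eq_bigr => s _; rewrite big_flatten big_map [X in _ *: X]exchange_big scaler_sumr /=.
apply: eq_bigr => t _; rewrite big_map [X in _ *: X]exchange_big scaler_sumr /=.
apply: eq_bigr => ls _.
by rewrite /sem_mono /factor /= big_nil expr0 !mulr1 scalerA.
Qed.
End ZeroModes.

(** * Proof of the theorem *)

Section Assembly.
Variables (C : numFieldType) (M N : nat) (V : lmodType C).
Variables (rho : affineRep M N V) (k : 'I_N -> C) (vac : V).
Hypothesis M_gt0 : (0 < M)%N.
Hypothesis vacP : vacuum_like rho k vac.

Definition cfree (E : expr) : bool := all (fun t => cpow t.2 == 0%N) E.

Lemma label_at_diag (f : 'I_N -> C) F l : label_at f (fun => 0) (diag_label F) l = label_at f f F l.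
Proof. by rewrite /label_at /= expr0 mulr1 exprD. Qed.

(** On the diagonal only f occurs, and the partial fraction relation holds
    with g = 0 and c = 0. *)
Lemma sem_diag f c E : cfree E ->
  sem rho k vac f f c E = sem rho k vac f (fun => 0) 0 (diag E).
Proof.
elim: E => [|t E IH]; first by rewrite !sem_nil.
rewrite [cfree _]/= => /andP[/eqP t0 /IH {}IH]; rewrite [diag _]/= !sem_cons IH.
congr (_ *: (_ *: _) + _); rewrite /sem_mono /factor /= t0 !expr0 big_map.
congr ((_ * _) *: _).
  apply: eq_bigr => F _; apply: eq_bigr => l _.
  by rewrite label_at_diag.
apply: eq_bigr => e _; elim: (letters t.2) => // x ls IHls.
rewrite [map _ _]/= !word_cons IHls; apply: eq_bigr => l _.
by rewrite [lab _]/= label_at_diag.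
Qed.

Local Arguments Z_of_int : simpl never.

Lemma sem_dexpr_cmul f g c b E :
  sem rho k vac f g c (dexpr b (cmul E)) =
  ((if b then 1 else -1) * c ^+ 2) *: sem rho k vac f g c E
  + c *: sem rho k vac f g c (dexpr b E).
Proof.
have dcons v E' : dexpr b (v :: E') = scale v.1 (dmono b v.2) ++ dexpr b E' by [].
elim: E => [|t E IH]; first by rewrite !sem_nil !scaler0 addr0.
rewrite [cmul _]/= !dcons !sem_cat !sem_scale sem_cons IH /= !scalerDr addrACA.
congr (_ + _); rewrite !sem_expand.
set w := t.2; set w1 := Mono _ _ _ _.
have dE : expand rho k vac f g c (dmono b w1) =
    ((if b then 1 else -1) * c ^+ 2) *: sem_mono rho k vac f g c w
    + c *: expand rho k vac f g c (dmono b w).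
  rewrite /expand /dmono !big_cons !big_cat !big_map !scalerDr /= !addrA.
  congr (_ + _ + _).
  - rewrite /sem_mono /factor /= !scalerA -scalerDl; congr (_ *: _).
    by case: (b); rewrite ?zCN !zC_int -!pmulrn !exprS; ring.
  - rewrite scaler_sumr; apply: eq_bigr => s _.
    by rewrite /sem_mono /factor /= !scalerA; congr (_ *: _); rewrite !exprS; ring.
  - rewrite scaler_sumr; apply: eq_bigr => s _.
    by rewrite /sem_mono /factor /= !scalerA; congr (_ *: _); rewrite !exprS; ring.
rewrite dE !scalerDr !scalerA; congr (_ *: _ + _ *: _); last ring.
by move: (if b then 1 else -1 : C) => s; ring.
Qed.

Variable p : 'I_N -> C.
Variable I : (\dim (sl C M)).-tuple 'M[C]_M.
Hypothesis IP : orthonormal_basis I.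
Variables (T : {linear V -> V}) (Y : V -> int -> {linear V -> V}).
Hypothesis TP : is_translation rho vac T.
Hypothesis YP : is_vacuum_vertex_algebra rho vac T Y.

(** The witnesses are c times the rational function of G, and that of B. *)
Lemma potentials i j (G B Z : expr) :
    (1 <= i <= 2)%N -> (1 <= j <= 2)%N -> cfree G ->
    zero_mode_identity i j G B && diag_identity G Z ->
  exists A B : vrat V,
    (forall z w : C,
       (forall l, z != p l) -> (forall l, w != p l) ->
       vrat_defined A z w -> vrat_defined B z w ->
       Y (varsigma rho vac p I i z) 0 (varsigma rho vac p I j w) =
       j%:R *: Dz M p k i A z w - i%:R *: Dw M p k j A z w
       + T (vrat_eval B z w)) /\
    regular_diag_mod T A.
Proof.
move=> i12 j12 Gc /andP[zeroP diagP].
pose on_sites z w := (forall l, z != p l) /\ forall l, w != p l.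
pose off_diag z w := on_sites z w /\ z != w.
have sitesP z w : on_sites z w -> forall l, z != p l /\ w != p l by case.
have offP z w : off_diag z w -> forall l, z != p l /\ w != p l by case=> /sitesP.
have [G0 G0P] := rep_sem rho k vac sitesP (or_introl Gc).
have offc : all (fun t => cpow t.2 == 0%N) B \/ forall z w, off_diag z w -> z != w.
  by right => z w [].
have [B0 B0P] := rep_sem rho k vac offP offc.
(* The added zero term forces z != w wherever A is defined. *)
pose G1 : vrat V := (Ratio 1 1, 0) :: G0.
pose A := vmul (inv_zw C) idfun G1.
have oneE z w : (\d_(Ratio 1 1 : {ratio {poly {poly C}}})).[z, w] = 1.
  by rewrite d_Ratio ?oner_neq0 // !hornerC.
have G1P z w : on_sites z w ->
    [/\ vrat_defined G1 z w,
        vrat_eval G1 z w = sem rho k vac (site p z) (site p w) (z - w)^-1 G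
      & forall b, vrat_eval (vrat_deriv (dpoly b) G1) z w =
          sem rho k vac (site p z) (site p w) (z - w)^-1 (dexpr b G)].
  move=> zw; have [G0d G0v G0dv] := G0P z w zw; split.
  - by rewrite /vrat_defined /= oneE oner_neq0.
  - by rewrite /vrat_eval big_cons scaler0 add0r -G0v.
  - by move=> b; rewrite /vrat_eval big_cons scaler0 add0r -G0dv.
exists A, B0; split; last first.
  apply: (regular_simple_pole (S := [seq p l | l <- enum 'I_N])) => z zS.
  have zz : on_sites z z.
    by split=> l; apply: contraNneq zS => ->; apply: map_f; rewrite mem_enum.
  have [G1d -> _] := G1P z z zz; split=> //.
  exists (sem rho k vac (site p z) (fun => 0) 0 Z).
  rewrite sem_diag // -(sem_Texpr k M_gt0 _ _ _ TP); apply/eqP; rewrite -subr_eq0 -sem_sub.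
  apply/eqP; apply: (vanishes_sound M_gt0 vacP _ diagP) => l.
  by rewrite mulr0 mul0r.
move=> z w zp wp Ad _.
have inv_zwE : (\d_(inv_zw C)).[z, w] = z - w by rewrite d_Ratio ?zw_poly_neq0 // zw_polyE.
have zw : z != w.
  move: Ad; rewrite /A /vmul /= => /andP[+ _]; rewrite d_rmul ev2M inv_zwE oneE mulr1.
  by rewrite subr_eq0.
have zw0 : (\d_(inv_zw C)).[z, w] != 0 by rewrite inv_zwE subr_eq0.
have [G1d G1v G1dv] := G1P z w (conj zp wp).
have [_ B0v _] := B0P z w (conj (conj zp wp) zw).
set f := site p z in G1v G1dv B0v *; set g := site p w in G1v G1dv B0v *.
set c := (z - w)^-1 in G1v G1dv B0v *.
have fg l : f l * g l = c * (g l - f l).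
  rewrite /f /g /c /site; field.
  by rewrite !subr_eq0 zp wp zw.
have inv_val : rval (inv_zw C) z w = c.
  by rewrite /rval n_Ratio ?zw_poly_neq0 // inv_zwE !hornerC mul1r.
have Aval : vrat_eval A z w = sem rho k vac f g c (cmul G).
  by rewrite vmul_eval // inv_val G1v sem_cmul.
have Aderiv b : vrat_eval (vrat_deriv (dpoly b) A) z w =
    sem rho k vac f g c (dexpr b (cmul G)).
  rewrite vmul_deriv // inv_val G1v G1dv sem_dexpr_cmul; congr (_ *: _ + _).
  rewrite rderivE n_Ratio ?d_Ratio ?zw_poly_neq0 // dpoly1 !horner0 mul0r sub0r !hornerC mul1r.
  by rewrite dpoly_zw zw_polyE -exprVn; case: b; rewrite ?hornerN !hornerC ?opprK // mulNr.
have twistE : (twist p k z = level_at k f g (1, 0)%N) * (twist p k w = level_at k f g (0, 1)%N).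
  by split; apply: eq_bigr => l _; rewrite /label_at /= ?mulr1 ?mul1r mulrC.
rewrite (sem_zero_mode p M_gt0 vacP IP YP z w c i12 j12) B0v -(sem_Texpr k M_gt0 _ _ _ TP).
have /eqP := vanishes_sound M_gt0 vacP fg zeroP.
rewrite !sem_sub subr_eq0 subr_eq => /eqP ->; rewrite addrC; congr (_ + _).
rewrite sem_Dexpr /Dz /Dw (Aderiv false) (Aderiv true) Aval !twistE.
rewrite -!pmulrn natrM !scalerBr !scalerA opprB [X in _ = _ + X]addrC addrACA.
by rewrite -!scaleNr -scalerDl; congr (_ + _ + _ *: _); ring.
Qed.
End Assembly.

Theorem theorem3p3 (R : realType) (M N : nat) (hM : (3 <= M)%N) (hN : (1 <= N)%N)
    (p k : 'I_N -> R[i]) (hp : injective p) (hk : forall i, k i != - M%:R)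
    (I : (\dim (sl R[i] M)).-tuple 'M[R[i]]_M) (hI : orthonormal_basis I)
    (V : lmodType R[i]) (rho : affineRep M N V) (vac : V)
    (hV : is_vacuum_module rho k vac)
    (T : {linear V -> V}) (hT : is_translation rho vac T)
    (Y : V -> int -> {linear V -> V})
    (hY : is_vacuum_vertex_algebra rho vac T Y)
    (i j : nat) (hi : (1 <= i <= 2)%N) (hj : (1 <= j <= 2)%N) :
  exists A B : vrat V,
    (forall z w : R[i],
       (forall l, z != p l) -> (forall l, w != p l) ->
       vrat_defined A z w -> vrat_defined B z w ->
       Y (varsigma rho vac p I i z) 0 (varsigma rho vac p I j w) =
       j%:R *: Dz M p k i A z w - i%:R *: Dw M p k j A z w
       + T (vrat_eval B z w)) /\
    regular_diag_mod T A.
Proof.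
have M_gt0 : (0 < M)%N := ltnW (ltnW hM).
have solve := potentials M_gt0 (proj1 hV) p hI hT hY hi hj.
case: i hi solve => [|[|[|i]]] // _; case: j hj => [|[|[|j]]] // _ solve.
- exact: (solve G11 B11 Z11 isT identities11).
- exact: (solve G12 B12 Z12 isT identities12).
- exact: (solve G21 B21 Z21 isT identities21).
- exact: (solve G22 B22 Z22 isT identities22).
Qed.
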